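(* Let $X$ be a real Banach space. (a) If $X=c_0$, then $\mathrm{BS}_a(X,\mathbb{R})$ is norm-dense in $\mathcal{L}(X,\mathbb{R})$. (b) If $X=L_1[0,1]$, then $\mathrm{BS}_a(X,\mathbb{R})$ is norm-dense in $\mathcal{L}(X,\mathbb{R})$. (c) If $X=L_1[0,1]$, then the set of norm attaining operators without the adjusted Bhatia-Šemrl property, i.e. $\mathrm{NA}(X,\mathbb{R})\setminus \mathrm{BS}_a(X,\mathbb{R})$, is norm-dense in $\mathcal{L}(X,\mathbb{R})$. (d) If $X=C[0,1]$, then $\mathrm{BS}_a(X,\mathbb{R})$ is weak-$*$-dense in $\mathcal{L}(X,\mathbb{R})=X^*$. (e) If $X=C[0,1]$, then the set of norm attaining operators without the adjusted Bhatia-Šemrl property, i.e. $\mathrm{NA}(X,\mathbb{R})\setminus \mathrm{BS}_a(X,\mathbb{R})$, is norm-dense in $\mathcal{L}(X,\mathbb{R})$.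
   Context: All Banach spaces are real. $S_X$ is the unit sphere of $X$, and $\mathcal{L}(X,Y)$ is the space of bounded linear operators from $X$ to $Y$ with the operator norm, so $\mathcal{L}(X,\mathbb{R})=X^*$. For $T\in\mathcal{L}(X,Y)$ put $M_T=\{x\in S_X:\|Tx\|=\|T\|\}$; $T$ attains its norm if $M_T\neq\emptyset$, and $\mathrm{NA}(X,Y)$ is the set of norm attaining operators. For vectors $x,y$ of a Banach space: $x\perp_B y$ (Birkhoff-James orthogonality) means $\|x\|\le\|x+\lambda y\|$ for all $\lambda\in\mathbb{R}$; $x\perp_S y$ (strong Birkhoff-James orthogonality) means $\|x\|<\|x+\lambda y\|$ for all $\lambda\in\mathbb{R}\setminus\{0\}$. $\mathrm{BS}_a(X,Y)$ (operators with the adjusted Bhatia-Šemrl property) is the set of $T\in\mathrm{NA}(X,Y)$ such that for every $S\in\mathcal{L}(X,Y)$ with $T\perp_S S$ there is $x_0\in M_T$ with $Tx_0\perp_B Sx_0$. *)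

(* Defs.v *)
From HB Require Import structures.
From mathcomp Require Import all_boot all_order all_algebra generic_quotient.
From mathcomp Require Import all_classical all_reals all_analysis.
From mathcomp Require Import measurable_realfun ess_sup_inf.

Set Implicit Arguments.
Unset Strict Implicit.
Unset Printing Implicit Defensive.

Import Order.TTheory GRing.Theory Num.Theory.
Import numFieldNormedType.Exports.

Local Open Scope classical_set_scope.
Local Open Scope ring_scope.

Section sup_norm.
Context {R : realType} {V : normedModType R} {T : Type}.
Implicit Types f g : T -> V.

Definition bounded_on (A : set T) f := exists M : R, forall x, A x -> `|f x| <= M.

Definition sup_norm (A : set T) f : R := sup [set `|f x| | x in A].

Lemma bounded_onD A f g :
  bounded_on A f -> bounded_on A g -> bounded_on A (f + g).
Proof.
move=> [M fM] [N gN]; exists (M + N) => x Ax.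
by rewrite (le_trans (ler_normD _ _))// lerD// ?fM ?gN.
Qed.

Lemma bounded_onZ A f (a : R) : bounded_on A f -> bounded_on A (a *: f).
Proof.
by move=> [M fM]; exists (`|a| * M) => x Ax; rewrite normrZ ler_wpM2l ?fM.
Qed.

Lemma sup_norm_ub A f x : bounded_on A f -> A x -> `|f x| <= sup_norm A f.
Proof.
move=> [M fM] Ax; apply: ub_le_sup; last by exists x.
by exists M => _ [y Ay <-]; exact: fM.
Qed.

Lemma sup_norm_le A f (M : R) : A !=set0 ->
  (forall x, A x -> `|f x| <= M) -> sup_norm A f <= M.
Proof.
move=> [x Ax] fM; apply: ge_sup; first by exists `|f x|; exists x.
by move=> _ [y Ay <-]; exact: fM.
Qed.

Lemma sup_normD A f g : A !=set0 -> bounded_on A f -> bounded_on A g ->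
  sup_norm A (f + g) <= sup_norm A f + sup_norm A g.
Proof.
move=> A0 fb gb; apply: sup_norm_le => // x Ax.
by rewrite (le_trans (ler_normD _ _))// lerD// sup_norm_ub.
Qed.

Lemma sup_normZ A f (a : R) : A !=set0 -> bounded_on A f ->
  sup_norm A (a *: f) = `|a| * sup_norm A f.
Proof.
move=> A0 fb; apply/eqP; rewrite eq_le; apply/andP; split.
  by apply: sup_norm_le => // x Ax; rewrite normrZ ler_wpM2l// sup_norm_ub.
have [->|a0] := eqVneq a 0.
  rewrite normr0 mul0r scale0r; case: A0 => x Ax.
  apply: le_trans (@sup_norm_ub A 0 x _ Ax) => //.
  by exists 0 => y _; rewrite normr0.
rewrite mulrC -ler_pdivlMr ?normr_gt0//; apply: sup_norm_le => // x Ax.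
rewrite ler_pdivlMr ?normr_gt0// mulrC -normrZ.
exact: (sup_norm_ub (bounded_onZ a fb)).
Qed.

Lemma sup_norm_eq0 A f x : bounded_on A f -> sup_norm A f = 0 -> A x -> f x = 0.
Proof.
move=> fb f0 Ax; apply/eqP; rewrite -normr_le0 -f0; exact: sup_norm_ub.
Qed.

End sup_norm.

Section bounded_operators.
Context {R : realType} (X Y : normedModType R).

Definition bounded_linear : {pred (X -> Y)} :=
  mem [set f : X -> Y | linear f /\ bounded_fun_norm f].

Record bop := Bop { bop_fun :> X -> Y ; _ : bop_fun \in bounded_linear }.

HB.instance Definition _ := [isSub for bop_fun].
HB.instance Definition _ := [Choice of bop by <:].

Definition unit_ball : set X := [set x | `|x| <= 1].

Let unit_ball0 : unit_ball !=set0.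
Proof. by exists 0; rewrite /unit_ball/= normr0. Qed.

Lemma bounded_linear_submod_closed : submod_closed bounded_linear.
Proof.
split.
  rewrite inE -[0]/(cst 0); split.
    by move=> a u v; rewrite /cst scaler0 addr0.
  by move=> r; exists 0 => x _; rewrite normr0.
move=> a f g /[!inE] -[lf bf] [lg bg]; split.
  move=> b u v; rewrite -[LHS]/(a *: f (b *: u + v) + g (b *: u + v)) lf lg.
  by rewrite scalerDr scalerA mulrC -scalerA addrACA -scalerDr.
move=> r; have [M fM] := bf r; have [N gN] := bg r.
exists (`|a| * M + N) => x xr; rewrite !fctE (le_trans (ler_normD _ _))//.
by rewrite lerD ?gN// normrZ ler_wpM2l// fM.
Qed.

HB.instance Definition _ :=
  GRing.isSubmodClosed.Build R _ bounded_linear bounded_linear_submod_closed.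
HB.instance Definition _ := [SubChoice_isSubLmodule of bop by <:].

Definition op_norm (T : bop) : R := sup_norm unit_ball T.

Lemma bop_linear (T : bop) : linear T.
Proof. by case: T => f /= /[!inE] -[]. Qed.

Lemma bop_bounded (T : bop) : bounded_on unit_ball T.
Proof. by case: T => f /= /[!inE] -[_ /(_ 1)]. Qed.

Let op_normD (S T : bop) : op_norm (S + T) <= op_norm S + op_norm T.
Proof. by apply: sup_normD => //; exact: bop_bounded. Qed.

Let op_normZ (a : R) (T : bop) : op_norm (a *: T) = `|a| * op_norm T.
Proof. by apply: sup_normZ => //; exact: bop_bounded. Qed.

Let op_norm_eq0 (T : bop) : op_norm T = 0 -> T = 0.
Proof.
move=> T0; apply/val_inj/funext => x /=.
have T00 : T 0 = 0.
  by have := bop_linear T 1 0 0; rewrite !scale1r addr0 => /eqP;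
    rewrite -subr_eq0 opprD addrA subrr sub0r oppr_eq0 => /eqP.
have [->//|x0] := eqVneq x 0.
have : T (`|x|^-1 *: x) = 0.
  apply: (sup_norm_eq0 (bop_bounded T) T0); rewrite /unit_ball/= normrZ.
  by rewrite normfV normr_id mulVf// normr_eq0.
rewrite -[X in T X]addr0 bop_linear T00 addr0 => /eqP.
by rewrite scaler_eq0 invr_eq0 normr_eq0 (negbTE x0) => /eqP.
Qed.

HB.instance Definition _ :=
  Lmodule_isNormed.Build R bop op_normD op_normZ op_norm_eq0.

End bounded_operators.

Section Birkhoff_James.
Context {R : realType} {V : normedModType R}.
Implicit Types x y : V.

Definition BJ_orth x y := forall l : R, `|x| <= `|x + l *: y|.

Definition strong_BJ_orth x y := forall l : R, l != 0 -> `|x| < `|x + l *: y|.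

End Birkhoff_James.

Section Bhatia_Semrl.
Context {R : realType} (X Y : normedModType R).

Definition norm_attainment (T : bop X Y) : set X :=
  [set x | `|x| = 1 /\ `|T x| = `|T|].

Definition NA : set (bop X Y) := [set T | norm_attainment T !=set0].

Definition BSa : set (bop X Y) :=
  [set T | NA T /\ forall S : bop X Y, strong_BJ_orth T S ->
    exists2 x0, norm_attainment T x0 & BJ_orth (T x0) (S x0)].

End Bhatia_Semrl.
Arguments NA {R} X Y.
Arguments BSa {R} X Y.

Definition weak_star_dual {R : realType} (X : normedModType R) :=
  initial_topology (fun T : bop X R => (T : {ptws X -> R})).

Section c0.
Context (R : realType).

Definition null_seq : {pred (nat -> R)} :=
  mem [set u : nat -> R | u @ \oo --> (0 : R)].

Record c0 := C0 { c0_seq :> nat -> R ; _ : c0_seq \in null_seq }.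

HB.instance Definition _ := [isSub for c0_seq].
HB.instance Definition _ := [Choice of c0 by <:].

Lemma null_seq_submod_closed : submod_closed null_seq.
Proof.
split; first by rewrite inE; exact: cvg_cst.
move=> a u v /[!inE] u0 v0.
have -> : (0 : R) = a *: 0 + 0 by rewrite scaler0 addr0.
by apply: cvgD => //; apply: cvgZr.
Qed.

HB.instance Definition _ :=
  GRing.isSubmodClosed.Build R _ null_seq null_seq_submod_closed.
HB.instance Definition _ := [SubChoice_isSubLmodule of c0 by <:].

Let setT_nat : [set: nat] !=set0. Proof. by exists 0%N. Qed.

Lemma c0_bounded (u : c0) : bounded_on setT u.
Proof.
case: u => u /= /[!inE] u0.
have /cvg_seq_bounded[M [_ uM]] : cvgn u by apply/cvg_ex; exists 0.
by exists (M + 1) => n _; apply: uM => //; rewrite ltrDl.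
Qed.

Definition c0_norm (u : c0) : R := sup_norm setT u.

Let c0_normD (u v : c0) : c0_norm (u + v) <= c0_norm u + c0_norm v.
Proof. by apply: sup_normD => //; exact: c0_bounded. Qed.

Let c0_normZ (a : R) (u : c0) : c0_norm (a *: u) = `|a| * c0_norm u.
Proof. by apply: sup_normZ => //; exact: c0_bounded. Qed.

Let c0_norm_eq0 (u : c0) : c0_norm u = 0 -> u = 0.
Proof.
move=> u0; apply/val_inj/funext => n.
exact: (sup_norm_eq0 (c0_bounded u) u0).
Qed.

HB.instance Definition _ :=
  Lmodule_isNormed.Build R c0 c0_normD c0_normZ c0_norm_eq0.

End c0.

Section Lspace_normed.
Context d (T : measurableType d) (R : realType).
Variables (mu : {measure set T -> \bar R}) (p : \bar R) (p1 : (1 <= p)%E).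
Local Open Scope quotient_scope.

Local Notation Lfn := (LfunType mu p1).
Local Notation Lsp := (LspaceType mu p1).

Lemma ae_eq_Lnorm (f g : T -> R) :
  measurable_fun setT f -> measurable_fun setT g -> f = g %[ae mu] ->
  'N[mu]_p[EFin \o f]%E = 'N[mu]_p[EFin \o g]%E.
Proof.
move=> mf mg fg; rewrite unlock /Lnorm; case: p p1 => [r r1|_|//].
  have mpow (h : T -> R) : measurable_fun setT h ->
      measurable_fun setT ((fun x => `|(EFin \o h) x| `^ r)%E : T -> \bar R).
    move=> mh; apply: (@measurableT_comp _ _ _ _ _ _ (fun x => x `^ r)%E) => /=.
      exact: measurable_poweR.
    by do 2 apply: measurableT_comp => //.
  congr (_ `^ _)%E; apply: ae_eq_integral => //; [exact: mpow|exact: mpow|].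
  by apply: filterS fg => x /= /[apply] ->.
by case: ifPn => // _; apply: eq_ess_sup; apply: filterS fg => x /= ->.
Qed.

Local Notation mfunR := {mfun T >-> measurableTypeR R}.
Local Notation aeMfun := {mfun_ mu, T >-> measurableTypeR R}.

Lemma Lspace_Lfun (f : Lsp) : (f : T -> R) \in Lfun mu p.
Proof.
apply/andP; split; rewrite inE/=; last exact: Lebesgue_finite.
exact: (@measurable_funPT _ _ _ _ (repr (f : aeMfun))).
Qed.

Definition Lspace_repr (f : Lsp) : Lfn := Lfun_Sub p1 (Lspace_Lfun f).

Definition Lfun_mfun (h : Lfn) : mfunR :=
  HB.pack (h : T -> measurableTypeR R)
    (@isMeasurableFun.Build d _ T (measurableTypeR R) h (@measurable_funPT _ _ _ _ h)).

Lemma Lfun_class_ae (h : Lfn) :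
  (repr (\pi_aeMfun (Lfun_mfun h)) : T -> R) = (h : T -> R) %[ae mu].
Proof.
have /eqmodP/asboolP : \pi_aeMfun (repr (\pi_aeMfun (Lfun_mfun h))) =
    \pi_aeMfun (Lfun_mfun h) by rewrite reprK.
exact.
Qed.

Lemma Lfun_class_finite (h : Lfn) :
  finite_norm mu p (\pi_aeMfun (Lfun_mfun h) : aeMfun).
Proof.
rewrite /finite_norm (@ae_eq_Lnorm _ h)//.
- exact: Lfunction_finite.
- exact: (@measurable_funPT _ _ _ _ (repr (\pi_aeMfun (Lfun_mfun h)))).
- exact: Lfun_class_ae.
Qed.

Definition Lspace_class (h : Lfn) : Lsp :=
  HB.pack (\pi_aeMfun (Lfun_mfun h) : aeMfun)
    (@isFinLebesgue.Build d T R mu p p1 (\pi_aeMfun (Lfun_mfun h) : aeMfun)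
      (Lfun_class_finite h)).

Lemma Lspace_eqP (f g : Lsp) :
  (f : T -> R) = (g : T -> R) %[ae mu] -> f = g.
Proof.
case: f g => [f [[ff]]] [g [[gf]]] /= fg.
have {}fg : f = g.
  by rewrite -[f]reprK -[g]reprK; apply/eqmodP/asboolP.
by rewrite fg in ff *; rewrite (Prop_irrelevance ff gf).
Qed.

Lemma Lspace_class_eq (h k : Lfn) :
  (h : T -> R) = k %[ae mu] -> Lspace_class h = Lspace_class k.
Proof.
move=> hk; apply: Lspace_eqP.
apply: filterS3 hk (Lfun_class_ae h) (Lfun_class_ae k) => x hk hx kx xT.
exact: etrans (hx xT) (etrans (hk xT) (esym (kx xT))).
Qed.

Lemma Lspace_reprK : cancel Lspace_repr Lspace_class.
Proof. by move=> f; apply: Lspace_eqP; exact: Lfun_class_ae. Qed.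

Lemma Lspace_classK (h : Lfn) :
  (Lspace_repr (Lspace_class h) : T -> R) = h %[ae mu].
Proof. exact: Lfun_class_ae. Qed.

Lemma Lspace_ind (P : Lsp -> Prop) :
  (forall h, P (Lspace_class h)) -> forall f, P f.
Proof. by move=> Ph f; rewrite -[f]Lspace_reprK. Qed.

HB.instance Definition _ := gen_eqMixin Lsp.
HB.instance Definition _ := gen_choiceMixin Lsp.

Definition Lspace_add (f g : Lsp) : Lsp :=
  Lspace_class (Lspace_repr f + Lspace_repr g).
Definition Lspace_opp (f : Lsp) : Lsp := Lspace_class (- Lspace_repr f).
Definition Lspace_scale (a : R) (f : Lsp) : Lsp :=
  Lspace_class (a *: Lspace_repr f).

Let classD h k : Lspace_add (Lspace_class h) (Lspace_class k) =
  Lspace_class (h + k).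
Proof.
apply: Lspace_class_eq.
apply: filterS2 (Lspace_classK h) (Lspace_classK k) => x /= + + xT.
by move=> /(_ xT) hE /(_ xT) kE; congr (_ + _).
Qed.

Let classN h : Lspace_opp (Lspace_class h) = Lspace_class (- h).
Proof.
apply: Lspace_class_eq.
apply: filterS (Lspace_classK h) => x /= + xT.
by move=> /(_ xT) hE; congr (- _).
Qed.

Let classZ a h : Lspace_scale a (Lspace_class h) = Lspace_class (a *: h).
Proof.
apply: Lspace_class_eq.
apply: filterS (Lspace_classK h) => x /= + xT.
by move=> /(_ xT) hE; congr (_ *: _).
Qed.

Let addA : associative Lspace_add.
Proof.
elim/Lspace_ind => f; elim/Lspace_ind => g; elim/Lspace_ind => h.
by rewrite !classD addrA.
Qed.

Let addC : commutative Lspace_add.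
Proof.
by elim/Lspace_ind => f; elim/Lspace_ind => g; rewrite !classD addrC.
Qed.

Let add0 : left_id (Lspace_class 0) Lspace_add.
Proof. by elim/Lspace_ind => f; rewrite classD add0r. Qed.

Let addN : left_inverse (Lspace_class 0) Lspace_opp Lspace_add.
Proof. by elim/Lspace_ind => f; rewrite classN classD addNr. Qed.

HB.instance Definition _ := GRing.isZmodule.Build Lsp addA addC add0 addN.

Lemma Lspace_classD h k :
  Lspace_class h + Lspace_class k = Lspace_class (h + k).
Proof. exact: classD. Qed.

Let scaleA a b (f : Lsp) :
  Lspace_scale a (Lspace_scale b f) = Lspace_scale (a * b) f.
Proof. by elim/Lspace_ind: f => f; rewrite !classZ scalerA. Qed.

Let scale1 : left_id 1 Lspace_scale.
Proof. by elim/Lspace_ind => f; rewrite classZ scale1r. Qed.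

Let scaleDr : right_distributive Lspace_scale +%R.
Proof.
move=> a; elim/Lspace_ind => f; elim/Lspace_ind => g.
by rewrite !(classZ, Lspace_classD) scalerDr.
Qed.

Let scaleDl (f : Lsp) : {morph Lspace_scale^~ f : a b / a + b}.
Proof.
by elim/Lspace_ind: f => f a b; rewrite !(classZ, Lspace_classD) scalerDl.
Qed.

HB.instance Definition _ :=
  GRing.Zmodule_isLmodule.Build R Lsp scaleA scale1 scaleDr scaleDl.

Lemma Lspace_classZ a h : a *: Lspace_class h = Lspace_class (a *: h).
Proof. exact: classZ. Qed.

Definition Lspace_norm (f : Lsp) : R := fine 'N[mu]_p[EFin \o (f : T -> R)]%E.

Let norm_class (h : Lfn) :
  Lspace_norm (Lspace_class h) = fine 'N[mu]_p[EFin \o h]%E.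
Proof.
congr fine; apply: ae_eq_Lnorm; last exact: Lfun_class_ae.
- exact: (@measurable_funPT _ _ _ _ (repr (\pi_aeMfun (Lfun_mfun h)))).
- exact: (@measurable_funPT _ _ _ _ h).
Qed.

Let normD (f g : Lsp) : Lspace_norm (f + g) <= Lspace_norm f + Lspace_norm g.
Proof.
elim/Lspace_ind: f => f; elim/Lspace_ind: g => g.
by rewrite Lspace_classD !norm_class ler_LnormD.
Qed.

Let normZ a (f : Lsp) : Lspace_norm (a *: f) = `|a| * Lspace_norm f.
Proof.
elim/Lspace_ind: f => f; rewrite Lspace_classZ !norm_class.
by apply/EFin_inj; rewrite EFinM !finite_norm_fine LnormZ.
Qed.

Let norm_eq0 (f : Lsp) : Lspace_norm f = 0 -> f = 0.
Proof.
elim/Lspace_ind: f => f; rewrite norm_class => /fine_Lnormr_eq0 f0.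
exact: Lspace_class_eq.
Qed.

HB.instance Definition _ := Lmodule_isNormed.Build R Lsp normD normZ norm_eq0.

End Lspace_normed.

Section C01.
Context (R : realType).

Local Notation I01 := (`[0 : R, 1]%classic : set R).

Definition C01 : Type := continuousType (set_type I01) R.

Definition continuous_pred : {pred (set_type I01 -> R)} :=
  mem [set f : set_type I01 -> R | continuous f].

Definition C01_sub f (cf : f \in continuous_pred) : C01 := mkcts (set_mem cf).

Lemma C01_rect (K : C01 -> Type) :
  (forall f (cf : f \in continuous_pred), K (C01_sub cf)) -> forall u, K u.
Proof.
move=> Ksub u; have cu : (u : _ -> _) \in continuous_pred.
  by rewrite inE; exact: cts_fun.
by have -> : u = C01_sub cu; [exact/continuousEP|exact: Ksub].
Qed.

Lemma C01_valP f (cf : f \in continuous_pred) : C01_sub cf = f :> (_ -> _).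
Proof. by []. Qed.

HB.instance Definition _ := isSub.Build _ _ C01 C01_rect C01_valP.
HB.instance Definition _ := [Choice of C01 by <:].

Lemma continuous_submod_closed : submod_closed continuous_pred.
Proof.
split; first by rewrite inE => x; apply: cvg_cst; exact: nbhs_filter.
move=> a f g /[!inE] cf cg x.
have fx : Filter (nbhs x) by exact: nbhs_filter.
apply: (@cvgD _ _ _ _ fx (fun t => a *: f t) g); last exact: cg.
by apply: (@cvgZr _ _ _ _ fx a f); exact: cf.
Qed.

HB.instance Definition _ :=
  GRing.isSubmodClosed.Build R _ continuous_pred continuous_submod_closed.
HB.instance Definition _ := [SubChoice_isSubLmodule of C01 by <:].

Let I01_neq0 : [set: set_type I01] !=set0.
Proof.
have h : (0 : R) \in I01 by rewrite inE/= in_itv/= lexx ler01.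
by exists (exist _ 0 h).
Qed.

Lemma C01_bounded (f : C01) : bounded_on setT f.
Proof.
have /continuous_compact/(_ (@segment_compact R 0 1)) :
    {within I01, continuous (valL f)}.
  apply/subspace_valL_continuousP. exact: (@cts_fun _ _ f).
move=> /compact_bounded/pinfty_ex_gt0[M _ fM]; exists M => x _; apply: fM.
exists (val x); first exact: set_valP.
by rewrite -[RHS](congr1 (@^~ x) (valLK point (f : _ -> _))).
Qed.

Definition C01_norm (f : C01) : R := sup_norm setT f.

Let C01_normD (f g : C01) : C01_norm (f + g) <= C01_norm f + C01_norm g.
Proof. by apply: sup_normD => //; exact: C01_bounded. Qed.

Let C01_normZ (a : R) (f : C01) : C01_norm (a *: f) = `|a| * C01_norm f.
Proof. by apply: sup_normZ => //; exact: C01_bounded. Qed.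

Let C01_norm_eq0 (f : C01) : C01_norm f = 0 -> f = 0.
Proof.
move=> f0; apply/val_inj/funext => x.
exact: (sup_norm_eq0 (C01_bounded f) f0).
Qed.

HB.instance Definition _ :=
  Lmodule_isNormed.Build R C01 C01_normD C01_normZ C01_norm_eq0.

End C01.

(** Functions on [[0, 1]] are encoded as functions on [R] modulo equality
    almost everywhere for the Lebesgue measure restricted to [[0, 1]], so that
    the values outside of [[0, 1]] are irrelevant. *)
Definition L1_01 (R : realType) : Type :=
  LspaceType1 (mrestr (@lebesgue_measure R)
    (measurable_itv `[0 : R, 1] : measurable `[0 : R, 1]%classic)).

(* Main.v *)
From HB Require Import structures.
Require Import Defs.
From mathcomp Require Import all_boot all_order all_algebra.
From mathcomp Require Import all_classical all_reals all_analysis.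
From mathcomp Require Import ring lra measurable_realfun.
Import Order.TTheory GRing.Theory Num.Theory.
Import numFieldNormedType.Exports.
Local Open Scope classical_set_scope.
Local Open Scope ring_scope.

Set Implicit Arguments.
Unset Strict Implicit.
Unset Printing Implicit Defensive.

(** A functional [T] belongs to [BSa] as soon as the distance from every [x] in
    the unit ball to the face [{y : |y| = 1, T y = |T|}] is at most a multiple
    of the defect [|T| - T x].  If [T] is strongly orthogonal to [S], then [S]
    vanishes at a norming vector: otherwise [S], up to sign, is positive on that
    (convex) face, and [|T - t *: S| <= |T|] for small [t > 0].  Such
    functionals are the finitely supported ones on [c0], the finite combinations
    of point evaluations on [C01], and on [L1] the densities [g] such that [|g|]
    equals [M] on a set of positive measure and is at most [M - e] elsewhere.

    Conversely, let [k] be an [L1] density attaining its maximal modulus on a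
    set [A] of positive measure while [|k|] comes arbitrarily close to it
    outside of [A].  The density equal to [sign k] on [A] and to [- sign k]
    outside of [A] defines a functional to which [k] is strongly orthogonal and
    which vanishes at no norming vector.  On [C01], a norm attaining measure
    whose support contains a point [q] of mass zero is strongly orthogonal to
    the evaluation at [q], which is nonzero at every norming vector. *)

(** Strong orthogonality of [T] to [S] is refuted by a single [t != 0] with [|T - t *: S| <= |T|].
    Positivity of [S] on the face does not alone provide one, since vectors that nearly attain the
    norm may stay far from the face; a uniform constant in the defect bound excludes this.

    On [C01] the norm closure of the finite combinations of point evaluations consists of the purely
    atomic measures, so these combinations reach a general functional only pointwise.

    On L1 a density can be modified freely on the measurable set where it is nearly extremal. On
    [C01] the obstacle is continuity: the sign of a measure is in general not a continuous function,
    so the norm need not be attained. The functional is split into positive parts [P] and [N] by its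
    total variation, and a function [x0] that nearly attains the norm stands in for the Hahn
    decomposition: cutoffs of [x0] keep most of [P] where [x0] is positive and most of [N] where it
    is negative. Near a point that carries little mass both parts are erased, and a small multiple
    of a functional concentrating at that point without charging it is put in their place. *)

Section bounded_operators.
Context {R : realType} {X Y : normedModType R}.
Implicit Types S T : bop X Y.

HB.instance Definition _ T := GRing.isLinear.Build R X Y _ (bop_fun T) (bop_linear T).

Lemma bop_ge T x : `|T x| <= `|T| * `|x|.
Proof.
have [->|x0] := eqVneq x 0; first by rewrite linear0 !normr0 mulr0.
have nx : 0 < `|x| by rewrite normr_gt0.
have Tb := bop_bounded T.
have ub : unit_ball (`|x|^-1 *: x).
  by rewrite /unit_ball/= normrZ normfV normr_id mulVf// gt_eqF.
have := sup_norm_ub Tb ub.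
by rewrite linearZ/= normrZ normfV normr_id mulrC ler_pdivrMr.
Qed.

Lemma bop_le T x : `|x| <= 1 -> `|T x| <= `|T|.
Proof. by move=> x1; rewrite (le_trans (bop_ge T x))// ler_piMr. Qed.

Lemma bop_norm_le T M : (forall x, `|x| <= 1 -> `|T x| <= M) -> `|T| <= M.
Proof.
by move=> TM; apply: sup_norm_le => //; exists 0; rewrite /unit_ball/= normr0.
Qed.

Lemma bounded_linearP (f : X -> Y) (M : R) : linear f ->
  (forall x, `|f x| <= M * `|x|) -> f \in @bounded_linear R X Y.
Proof.
move=> lf fM; rewrite inE; split=> // r; exists (`|M| * r) => x xr.
rewrite (le_trans (fM x))// (le_trans (ler_wpM2r _ (ler_norm M)))//.
by rewrite ler_wpM2l.
Qed.

Definition mkbop (f : X -> Y) (M : R) (lf : linear f)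
  (fM : forall x, `|f x| <= M * `|x|) : bop X Y := Bop (bounded_linearP lf fM).

Lemma norm_dense (A : set (bop X Y)) :
  (forall T (e : R), 0 < e -> exists2 S, A S & `|T - S| <= e) -> dense A.
Proof.
move=> AT O [T OT] oO; have /nbhs_ballP[e /= e0 eO] := open_nbhs_nbhs (conj oO OT).
have [S AS TS] := AT T (e / 2) (divr_gt0 e0 (ltr0Sn _ 1)).
exists S; split=> //; apply: eO; rewrite -ball_normE /ball_/=.
by rewrite (le_lt_trans TS)// ltr_pdivrMr// ltr_pMr// ltr1n.
Qed.

End bounded_operators.

(** * Exposed faces and a sufficient condition for [BSa] *)

Section functionals.
Context {R : realType} {X : normedModType R}.
Implicit Types S T : bop X R.

Lemma functional_norm_le T M : (forall x, `|x| <= 1 -> T x <= M) -> `|T| <= M.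
Proof.
move=> TM; apply: bop_norm_le => x x1; rewrite ler_norml TM// andbT.
by rewrite lerNl -linearN TM ?normrN.
Qed.

Lemma functional_near_norm T e : 0 < e -> exists2 x, `|x| <= 1 & `|T| - e < T x.
Proof.
move=> e0; apply: contrapT => Te.
have : `|T| <= `|T| - e.
  apply: functional_norm_le => x x1; rewrite leNgt; apply/negP => Tx.
  by apply: Te; exists x.
by rewrite lerBrDl gerDr leNgt e0.
Qed.

(** For a nonzero functional [T], [BSa] therefore asks for a norming vector in the kernel of [S]. *)
Lemma scalar_BJ_orth (a b : R) : a != 0 -> BJ_orth a b <-> b = 0.
Proof.
move=> a0; split=> [ab|->]; last by move=> l; rewrite scaler0 addr0.
apply/eqP; apply: contraT => b0; have := ab (- a / b).
by rewrite /GRing.scale/= mulfVK// subrr normr0 normr_le0 (negbTE a0).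
Qed.

Lemma strong_BJ_orthN {V : normedModType R} (x y : V) :
  strong_BJ_orth x y -> strong_BJ_orth x (- y).
Proof. by move=> xy l l0; rewrite scalerN -scaleNr; apply: xy; rewrite oppr_eq0. Qed.

Lemma BSa0 (x : X) : `|x| = 1 -> BSa X R 0.
Proof.
move=> x1; have x0 : norm_attainment (0 : bop X R) x.
  by split=> //; rewrite (_ : bop_fun 0 x = 0) ?normr0.
split; first by exists x.
by move=> S _; exists x => // l; rewrite (_ : bop_fun 0 x = 0) ?normr0.
Qed.

(* The hypothesis bounds the distance from [x] to the exposed face of the ball
   by a multiple of the defect [`|T| - T x].  If [S > 0] on that face, it forces
   [`|T - t *: S| <= `|T|] for small [t > 0]. *)
Lemma linear_exposing_BSa T (K : R) : T != 0 -> 0 < K ->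
  (forall x, `|x| <= 1 ->
    exists y, [/\ `|y| = 1, T y = `|T| & `|y - x| <= K * (`|T| - T x)]) ->
  BSa X R T.
Proof.
move=> T0 K0 TK; have nT : 0 < `|T| by rewrite normr_gt0.
have face_pos S : strong_BJ_orth T S ->
    exists y, [/\ `|y| = 1, T y = `|T| & S y <= 0].
  move=> TS; apply: contrapT => Sface.
  have Spos y : `|y| = 1 -> T y = `|T| -> 0 < S y.
    by move=> y1 Ty; rewrite ltNge; apply/negP => Sy; apply: Sface; exists y.
  (* With this [t], passing from [x] to its face point [y] changes [t * S] by at most the defect
     [|T| - T x], so [T x - t * S x <= |T| - t * S y]. The [+ 1] covers [S = 0]. *)
  pose t := (K * (`|S| + 1))^-1.
  have S1 : 0 < `|S| + 1 by rewrite ltr_wpDl.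
  have t0 : 0 < t by rewrite invr_gt0 mulr_gt0.
  have := TS (- t); rewrite oppr_eq0 gt_eqF// => /(_ isT).
  rewrite ltNge => /negP; apply; apply: functional_norm_le => x x1.
  have [y [y1 Ty yx]] := TK x x1.
  rewrite -[leLHS]/(T x + (- t) * S x).
  have Sy := Spos _ y1 Ty.
  have Syx : t * (S y - S x) <= t * ((`|S| + 1) * (K * (`|T| - T x))).
    rewrite ler_pM2l// -linearB (le_trans (ler_norm _))// (le_trans (bop_ge _ _))//.
    by apply: ler_pM => //; rewrite lerDl.
  have E : t * ((`|S| + 1) * (K * (`|T| - T x))) = `|T| - T x.
    by rewrite /t; field; rewrite !gt_eqF.
  rewrite E mulrBr in Syx; have tSy : 0 <= t * S y by rewrite mulr_ge0// ltW.
  rewrite mulNr; lra.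
have [y0 [y01 Ty0 _]] : exists y, [/\ `|y| = 1, T y = `|T| & `|y - 0| <= K * (`|T| - T 0)].
  by apply: TK; rewrite ?normr0.
split; first by exists y0; split=> //; rewrite Ty0 normr_id.
move=> S TS; have [y [y1 Ty Sy]] := face_pos S TS.
have [z [z1 Tz /=]] := face_pos _ (strong_BJ_orthN TS).
rewrite -[X in X <= _]/(- S z) oppr_le0 => Sz.
suff [x [x1 Tx Sx]] : exists x, [/\ `|x| = 1, T x = `|T| & S x = 0].
  exists x; first by split=> //; rewrite Tx normr_id.
  by rewrite Sx; apply/scalar_BJ_orth => //; rewrite Tx gt_eqF.
have [E|E] := eqVneq (S z - S y) 0.
  by exists y; split=> //; move/eqP: E; rewrite subr_eq0 => /eqP E; apply/le_anti; rewrite Sy -E Sz.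
(* The zero of [S] on the segment from [z] to [y], whose ends have values of opposite sign; the
   segment stays in the face. *)
pose a := S z / (S z - S y).
have d0 : 0 < S z - S y by rewrite lt_def E/= subr_ge0 (le_trans Sy).
have a0 : 0 <= a by rewrite divr_ge0// ltW.
have a1 : a <= 1 by rewrite ler_pdivrMr// mul1r lerDl oppr_ge0.
have Sa : a * S y + (1 - a) * S z = 0 by rewrite /a; field.
have {d0} Tx : T (a *: y + (1 - a) *: z) = `|T|.
  have -> : T (a *: y + (1 - a) *: z) = a * T y + (1 - a) * T z.
    by rewrite linearD !linearZ.
  by rewrite Ty Tz; ring.
move: a a0 a1 Sa Tx => {E} a a0 a1 Sa Tx.
exists (a *: y + (1 - a) *: z); split=> //; last first.
  by rewrite linearD !linearZ.
apply/le_anti/andP; split; last first.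
  rewrite -(@ler_pM2l _ `|T|)// mulr1 -[leLHS]normr_id -[X in `|X|]Tx.
  exact: bop_ge.
rewrite (le_trans (ler_normD _ _))// !normrZ y1 z1 !mulr1 (ger0_norm a0) ger0_norm ?subr_ge0//.
by rewrite subrKC.
Qed.

End functionals.

(** Source of the constant [m^-1] for finitely supported functionals: a defect [r] forces each
    active coordinate to lie within [r / m] of its extremal value. *)
Lemma seq_norm_gt0 (R : realType) (I : eqType) (s : seq I) (a : I -> R) :
  (forall i, i \in s -> a i != 0) ->
  exists2 m, 0 < m & forall i, i \in s -> m <= `|a i|.
Proof.
elim: s => [|i s IH] sa; first by exists 1.
have [j js|m m0 sm] := IH; first by rewrite sa// inE js orbT.
exists (Num.min m `|a i|); first by rewrite lt_min m0 normr_gt0 sa ?mem_head.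
by move=> j; rewrite inE ge_min => /predU1P[->|/sm ->//]; rewrite lexx orbT.
Qed.

(** * Finitely supported functionals on [c0] *)

Section c0.
Context {R : realType}.
Implicit Types (u : c0 R) (T : bop (c0 R) R).

Lemma c0_norm_ge u n : `|u n| <= `|u|.
Proof. by apply: sup_norm_ub => //; exact: c0_bounded. Qed.

Lemma c0_norm_le u M : (forall n, `|u n| <= M) -> `|u| <= M.
Proof. by move=> uM; apply: sup_norm_le => //; exists 0%N. Qed.

Lemma c0_cvg0 u : (u : nat -> R) @ \oo --> 0.
Proof. by case: u => u /= /[!inE]. Qed.

(** Only the tail decides membership in [c0]; truncations, unit vectors and patched vectors are all
    built this way. *)
Lemma c0_extP u (f : nat -> R) N :
  (forall n, (N <= n)%N -> f n = u n) -> f \in @null_seq R.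
Proof.
move=> fu; rewrite inE; apply: cvg_trans (c0_cvg0 u); apply: near_eq_cvg.
by exists N => // n /= Nn; rewrite fu.
Qed.

Lemma c0_trunc_subproof N u n :
  (N <= n)%N -> (if (n < N)%N then u n else 0) = (0 : c0 R) n.
Proof. by rewrite leqNgt => /negbTE ->. Qed.

Definition c0_trunc N u : c0 R := C0 (c0_extP (@c0_trunc_subproof N u)).

Lemma c0_truncE N u n : c0_trunc N u n = if (n < N)%N then u n else 0.
Proof. by []. Qed.

Lemma c0_trunc_linear N : linear (c0_trunc N).
Proof.
move=> a u v; apply/val_inj/funext => n /=.
rewrite -[RHS]/(a * c0_trunc N u n + c0_trunc N v n) !c0_truncE.
by case: ifP => //; rewrite mulr0 addr0.
Qed.

Lemma c0_trunc_norm N u : `|c0_trunc N u| <= `|u|.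
Proof.
apply: c0_norm_le => n; rewrite c0_truncE; case: ifP => _; last by rewrite normr0.
exact: c0_norm_ge.
Qed.

Lemma c0_trunc_cvg u e : 0 < e -> exists N, `|u - c0_trunc N u| <= e.
Proof.
move=> e0; have /cvgrPdist_le/(_ _ e0)[N _ uN] := c0_cvg0 u.
exists N; apply: c0_norm_le => n.
rewrite -[(u - _) n]/(u n - c0_trunc N u n) c0_truncE.
case: ltnP => nN; first by rewrite subrr normr0 ltW.
by rewrite subr0 -normrN -sub0r uN.
Qed.

Lemma bop_trunc_subproof N T : linear (T \o c0_trunc N).
Proof. by move=> a u v /=; rewrite c0_trunc_linear linearP. Qed.

Lemma bop_trunc_bound N T u : `|(T \o c0_trunc N) u| <= `|T| * `|u|.
Proof. by rewrite (le_trans (bop_ge _ _))// ler_wpM2l// c0_trunc_norm. Qed.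

Definition bop_trunc N T : bop (c0 R) R :=
  mkbop (@bop_trunc_subproof N T) (@bop_trunc_bound N T).

(** If a truncation of [x] nearly attains the norm of [T], it can be completed by any tail [v] of a
    unit ball vector without leaving the unit ball, because the supports are disjoint. So [T v]
    cannot exceed what is left of [|T|]. *)
Lemma bop_trunc_near T e : 0 < e -> exists N, `|T - bop_trunc N T| <= e.
Proof.
move=> e0; have [x x1 Tx] := functional_near_norm T (divr_gt0 e0 (ltr0Sn R 1)).
have e2 : 0 < e / 2 / (`|T| + 1) by rewrite !divr_gt0// ltr_wpDl.
have [N xN] := c0_trunc_cvg x e2.
exists N; apply: functional_norm_le => u u1.
rewrite -[leLHS]/(T u - T (c0_trunc N u)) -linearB.
set v := u - _.
have vN n : v n = if (n < N)%N then 0 else u n.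
  rewrite -[LHS]/(u n - c0_trunc N u n) c0_truncE.
  by case: ifP; rewrite ?subrr ?subr0.
have xv1 : `|c0_trunc N x + v| <= 1.
  apply: c0_norm_le => n; rewrite -[(_ + v) n]/(c0_trunc N x n + v n) vN c0_truncE.
  by case: ifP => _; rewrite ?addr0 ?add0r (le_trans (c0_norm_ge _ _)).
have := le_trans (ler_norm _) (bop_le T xv1).
have : `|T (x - c0_trunc N x)| <= e / 2.
  rewrite (le_trans (bop_ge _ _))// (le_trans (ler_wpM2l _ xN))//.
  by rewrite mulrCA ger_pMr ?divr_gt0// ler_pdivrMr ?ltr_wpDl// mul1r lerDl.
rewrite ler_norml linearB linearD => /andP[_].
lra.
Qed.

Definition c0_unit_subproof i n : (i.+1 <= n)%N -> (n == i)%:R = (0 : c0 R) n.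
Proof. by move=> ni; rewrite gtn_eqF. Qed.

Definition c0_unit i : c0 R := C0 (c0_extP (@c0_unit_subproof i)).

Lemma c0_trunc_sum N u : c0_trunc N u = \sum_(i < N) u i *: c0_unit i.
Proof.
elim: N => [|N IH]; first by rewrite big_ord0; apply/val_inj/funext.
rewrite big_ord_recr/= -IH; apply/val_inj/funext => n /=.
rewrite -[RHS]/(c0_trunc N u n + u N * (n == N)%:R) !c0_truncE ltnS.
by case: ltngtP => [| |->]; rewrite ?mulr0 ?addr0 ?mulr1 ?add0r.
Qed.

(** The face point near [u] is obtained by overwriting the coordinates in the support [F] with the
    signs of the coefficients. Each change, weighted by [|a n|], equals the contribution
    [|a n| - u n * a n] of that coordinate to the defect. *)
Lemma bop_trunc_BSa N T : BSa (c0 R) R (bop_trunc N T).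
Proof.
have [->|T0] := eqVneq (bop_trunc N T) 0.
  apply: (@BSa0 _ _ (c0_unit 0)); apply/le_anti/andP; split.
    by apply: c0_norm_le => -[|n]; rewrite /= ?normr1 ?normr0.
  by rewrite (le_trans _ (c0_norm_ge _ 0))//= normr1.
pose a i := T (c0_unit i).
pose F := [seq i <- iota 0 N | a i != 0].
have TE u : bop_trunc N T u = \sum_(i <- F) u i * a i.
  rewrite -[LHS]/(T (c0_trunc N u)) c0_trunc_sum linear_sum/= big_filter.
  rewrite -(big_mkord xpredT (fun i => T (u i *: c0_unit i))) /index_iota subn0.
  rewrite [RHS]big_mkcond/=; apply: eq_bigr => i _; rewrite linearZ/=.
  by case: ifPn => // /negPn/eqP ai; rewrite -[T _]/(a i) ai [LHS]mulr0.
have Fa i : i \in F -> a i != 0 by rewrite mem_filter => /andP[].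
have FN i : i \in F -> (i < N)%N by rewrite mem_filter mem_iota add0n => /and3P[].
pose patch u := fun n => if n \in F then Num.sg (a n) else u n.
have patchE u n : (N <= n)%N -> patch u n = u n.
  by rewrite /patch; case: ifPn => // /FN + nN; rewrite ltnNge nN.
pose y u : c0 R := C0 (c0_extP (patchE u)).
have yE u n : y u n = if n \in F then Num.sg (a n) else u n by [].
have sgF i : i \in F -> `|Num.sg (a i)| = 1 by move=> iF; rewrite normr_sg Fa.
have yball u : `|u| <= 1 -> `|y u| <= 1.
  move=> u1; apply: c0_norm_le => n; rewrite yE; case: ifPn => [/sgF ->//|_].
  exact: le_trans (c0_norm_ge _ _) u1.
have Ty u : bop_trunc N T (y u) = \sum_(i <- F) `|a i|.
  by rewrite TE; apply: eq_big_seq => i iF; rewrite yE iF -normrEsg.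
have normT : `|bop_trunc N T| = \sum_(i <- F) `|a i|.
  apply/le_anti/andP; split; last first.
    rewrite -(Ty 0) (le_trans (ler_norm _))// bop_le// yball// normr0//.
  apply: functional_norm_le => u u1; rewrite TE; apply: ler_sum => i _.
  rewrite (le_trans (ler_norm _))// normrM ler_piMl//.
  exact: le_trans (c0_norm_ge _ _) u1.
have [i0 i0F] : exists i, i \in F.
  case: F TE {Fa FN patch patchE y yE sgF yball Ty normT} => [TE|i F _]; last first.
    by exists i; rewrite mem_head.
  case/eqP: T0; apply/val_inj/funext => u; by rewrite /= -[LHS]/(bop_trunc N T u) TE big_nil.
have [m m0 mle] := seq_norm_gt0 Fa.
apply: (@linear_exposing_BSa _ _ _ m^-1); rewrite ?invr_gt0// => u u1.
exists (y u); split; last 1 first.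
- rewrite mulrC ler_pdivlMr// normT TE -sumrB.
  have yuF n : n \notin F -> `|(y u - u) n| = 0.
    by move=> nF; rewrite -[(y u - u) n]/(y u n - u n) yE (negbTE nF) subrr normr0.
  have yuF' n : n \in F -> m * `|(y u - u) n| <= `|a n| - u n * a n.
    move=> nF; rewrite -[(y u - u) n]/(y u n - u n) yE nF.
    rewrite (le_trans (ler_wpM2r _ (mle _ nF)))// -normrM mulrBr mulrC -normrEsg.
    rewrite (mulrC (u n)) ger0_norm// subr_ge0 (le_trans (ler_norm _))//.
    rewrite normrM ler_piMr//; exact: le_trans (c0_norm_ge _ _) u1.
  have pos n : n \in F -> 0 <= `|a n| - u n * a n.
    by move=> nF; rewrite (le_trans _ (yuF' n nF))// mulr_ge0// ltW.
  rewrite -ler_pdivlMr//; apply: c0_norm_le => n; rewrite ler_pdivlMr// mulrC.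
  have [nF|/yuF ->] := boolP (n \in F); last first.
    by rewrite mulr0 big_seq sumr_ge0.
  rewrite (big_rem n)//= (le_trans (yuF' n nF))// lerDl big_seq sumr_ge0// => i iF.
  by apply: pos; exact: mem_rem iF.
- apply/le_anti; rewrite yball//= (le_trans _ (c0_norm_ge _ i0))//.
  by rewrite yE i0F sgF.
- by rewrite Ty normT.
Qed.

Lemma BSa_c0_dense : dense (BSa (c0 R) R).
Proof.
apply: norm_dense => T e /bop_trunc_near-/(_ T)[N TN].
by exists (bop_trunc N T) => //; exact: bop_trunc_BSa.
Qed.

End c0.

(** * Point evaluations and partitions of unity on the unit interval *)

Section C01.
Context {R : realType}.
Local Notation I01 := (`[0 : R, 1]%classic : set R).
Local Notation I := (set_type I01).
Implicit Types (x y : C01 R) (s t : I) (T : bop (C01 R) R).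

Lemma clamp01_subproof (r : R) : Num.max 0 (Num.min 1 r) \in I01.
Proof. by rewrite inE/= in_itv/= le_max lexx/= ge_max ler01 ge_min lexx. Qed.

(** A continuous retraction of the line onto the subtype: it extends functions to the whole line and
    produces points without membership proofs. *)
Definition clamp01 (r : R) : I := exist (fun r => r \in I01) _ (clamp01_subproof r).

Lemma clamp01K : cancel (val : I -> R) clamp01.
Proof.
move=> t; apply/val_inj => /=; have := set_valP t; rewrite /= in_itv/= => /andP[t0 t1].
by rewrite (min_idPr t1) (max_idPr t0).
Qed.

Lemma val_continuous : continuous (val : I -> R).
Proof. exact: initial_continuous. Qed.

Lemma clamp01_continuous : continuous clamp01.
Proof.
apply/continuousP => _ [A oA <-].
suff /continuousP : continuous (val \o clamp01) by exact.
move=> r; apply: (@continuous_max R R (cst 0) (fun r => Num.min 1 r)); first exact: cvg_cst.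
by apply: (@continuous_min R R (cst 1) id); [exact: cvg_cst|exact: cvg_id].
Qed.

Lemma C01_cts x : continuous (x : I -> R).
Proof. exact: cts_fun. Qed.

Lemma mkC01_subproof (f : I -> R) : continuous f -> f \in @continuous_pred R.
Proof. by move=> cf; rewrite inE. Qed.

Definition mkC01 (f : I -> R) (cf : continuous f) : C01 R := C01_sub (mkC01_subproof cf).

Lemma C01_ext x y : (forall t, x t = y t) -> x = y.
Proof. by move=> xy; apply/val_inj/funext. Qed.

Lemma C01_norm_ge x t : `|x t| <= `|x|.
Proof. by apply: sup_norm_ub => //; exact: C01_bounded. Qed.

Lemma C01_norm_le x M : (forall t, `|x t| <= M) -> `|x| <= M.
Proof. by move=> xM; apply: sup_norm_le => //; exists (clamp01 0). Qed.

Lemma C01D x y t : (x + y) t = x t + y t. Proof. by []. Qed.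
Lemma C01N x t : (- x) t = - x t. Proof. by []. Qed.
Lemma C01B x y t : (x - y) t = x t - y t. Proof. by []. Qed.
Lemma C01Z (a : R) x t : (a *: x) t = a * x t. Proof. by []. Qed.

Lemma C01_sum J (r : seq J) (P : pred J) (F : J -> C01 R) t :
  (\sum_(i <- r | P i) F i) t = \sum_(i <- r | P i) F i t.
Proof.
by elim/big_rec2: _ => // i u v _ <-; rewrite C01D.
Qed.

Lemma mulC_subproof x y : continuous (fun t => x t * y t).
Proof. by move=> t; apply: continuousM; exact: C01_cts. Qed.
Definition mulC x y := mkC01 (@mulC_subproof x y).

Lemma maxC_subproof x y : continuous (fun t => Num.max (x t) (y t)).
Proof. by move=> t; apply: continuous_max; exact: C01_cts. Qed.
Definition maxC x y := mkC01 (@maxC_subproof x y).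

Lemma minC_subproof x y : continuous (fun t => Num.min (x t) (y t)).
Proof. by move=> t; apply: continuous_min; exact: C01_cts. Qed.
Definition minC x y := mkC01 (@minC_subproof x y).

Definition cstC (a : R) : C01 R := mkC01 (fun t => @cst_continuous I R a t).
Definition clipC (a b : R) x := maxC (cstC a) (minC (cstC b) x).

Lemma delta_subproof t : linear (fun x => x t).
Proof. by move=> a x y; rewrite C01D C01Z. Qed.

Lemma delta_bound t x : `|x t| <= 1 * `|x|.
Proof. by rewrite mul1r C01_norm_ge. Qed.

Definition delta t : bop (C01 R) R := mkbop (@delta_subproof t) (@delta_bound t).

Lemma C01_unif_continuous x e : 0 < e ->
  exists2 d, 0 < d & forall s t, `|val s - val t| < d -> `|x s - x t| <= e.
Proof.
move=> e0; pose f r := x (clamp01 r).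
have cf : continuous f.
  by move=> r; apply: continuous_comp; [exact: clamp01_continuous|exact: C01_cts].
(* Heine-Cantor by the covering form of compactness, with the modulus [d] tending to [0] from the
   right: continuity at [r] gives the property for all centres near [r] and all small [d] at
   once. *)
have /compact_near_coveringP := @segment_compact R 0 1.
move=> /(_ _ (0^'+) (fun d r => forall q, `|r - q| < d -> `|f r - f q| <= e)).
case=> [r _|d /= d0 dP].
  have /cvgrPdist_lt/(_ _ (divr_gt0 e0 (ltr0Sn R 1)))/nbhs_ballP[d /= d0 dP] := cf r.
  exists (ball r (d / 2), [set d' | 0 < d' < d / 2]); first split.
  - by apply: nbhsx_ballx; rewrite divr_gt0.
  - exists (d / 2); rewrite /= ?divr_gt0// => d' /=; rewrite sub0r normrN.
    by move=> d'd d'0; rewrite d'0 (le_lt_trans (ler_norm _)).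
  move=> [r' d'] [/= rr' /andP[d'0 d'd]] q r'q.
  have r'd : `|f r - f r'| < e / 2 by apply: dP; apply: le_ball rr'; rewrite ler_pdivrMr// ler_pMr// ler1n.
  have qd : `|f r - f q| < e / 2.
    apply: dP; rewrite -ball_normE/=; rewrite -ball_normE/= in rr'.
    rewrite (le_lt_trans (ler_distD r' _ _))// [ltRHS]splitr ltrD//.
    exact: lt_trans d'd.
  rewrite (le_trans (ler_distD (f r) _ _))// [leRHS]splitr lerD// ltW//.
  by rewrite distrC.
have d2 : 0 < d / 2 by rewrite divr_gt0.
exists (d / 2) => // s t st.
rewrite -(clamp01K s) -(clamp01K t); apply: (dP (d / 2)) => //.
- by rewrite /= sub0r normrN gtr0_norm// ltr_pdivrMr// ltr_pMr// ltr1n.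
- exact: set_valP.
Qed.

(* Normalized hat functions on the grid [i / N]. *)
Lemma C01_partition (d : R) : 0 < d -> exists (N : nat) (t : 'I_N.+1 -> I) (p : 'I_N.+1 -> C01 R),
  [/\ N.+1%:R^-1 < d,
      forall i s, 0 <= p i s,
      forall s, \sum_i p i s = 1,
      forall i j, p i (t j) = (i == j)%:R &
      forall i s, p i s != 0 -> `|val (t i) - val s| < d].
Proof.
move=> d0; pose N := (Num.truncn d^-1).+1.
have N0 : 0 < N%:R :> R by rewrite ltr0n.
have Nd : N%:R^-1 < d by rewrite invf_plt ?posrE// truncnS_gt.
pose t (i : 'I_N.+1) : I := clamp01 (i%:R / N%:R).
have tE i : val (t i) = i%:R / N%:R.
  rewrite /= (min_idPr _) ?(max_idPr _) ?divr_ge0//.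
  by rewrite ler_pdivrMr// mul1r ler_nat -ltnS.
pose h (i : 'I_N.+1) (s : I) : R := Num.max 0 (1 - `|N%:R * val s - i%:R|).
have ch i : continuous (h i).
  move=> s; apply: (@continuous_max R I (cst 0) (fun s => 1 - `|N%:R * val s - i%:R|)).
    exact: cst_continuous.
  apply: continuousB; first exact: cst_continuous.
  apply: (@continuous_comp _ _ _ _ (fun u : R => `|u|)); last exact: norm_continuous.
  apply: continuousB; last exact: cst_continuous.
  by apply: continuousM; [exact: cst_continuous|exact: val_continuous].
have h0 i s : 0 <= h i s by rewrite le_max lexx.
(* Dividing by the sum avoids checking that the hats already add up to one. The sum is positive
   because the grid point just to the left of [s] is at distance less than [1 / N]. *)
pose H s := \sum_i h i s.
have H0 s : 0 < H s.
  have /andP[s0 s1] : 0 <= val s <= 1 by have := set_valP s; rewrite /= in_itv.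
  have Ns0 : 0 <= N%:R * val s by rewrite mulr_ge0.
  have /andP[k1 k2] := truncn_itv Ns0.
  have kN : (Num.truncn (N%:R * val s) < N.+1)%N.
    by rewrite ltnS -(ler_nat R) (le_trans k1)// ler_piMr.
  rewrite /H (bigD1 (Ordinal kN))//= ltr_pwDl ?sumr_ge0//.
  by rewrite lt_max subr_gt0 ltr_norml ltrBrDr ltrBlDl; apply/orP; right; apply/andP; split; lra.
have cH : continuous H.
  rewrite (_ : H = fun s => (\sum_i mkC01 (ch i)) s); last first.
    by apply/funext => s; rewrite C01_sum.
  exact: C01_cts.
have cp i : continuous (fun s => h i s / H s).
  move=> s; apply: continuousM; first exact: ch.
  by apply: continuousV; [rewrite gt_eqF|exact: cH].
have hnz i s : h i s != 0 -> `|N%:R * val s - i%:R| < 1.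
  by apply: contraNT; rewrite -leNgt => hi; rewrite /h (max_idPl _)// subr_le0.
have ht i j : h i (t j) = (i == j)%:R.
  have Nn0 : N%:R != 0 :> R by rewrite gt_eqF.
  rewrite /h tE mulrC divfK//; case: (altP (i =P j)) => [->|ij].
    by rewrite subrr normr0 subr0 (max_idPr _).
  rewrite (max_idPl _)// subr_le0 ler_normr.
  have : (i < j)%N || (j < i)%N by rewrite -neq_ltn.
  by case/orP; rewrite -(ler_nat R) -natr1 => ?; apply/orP; [left|right]; lra.
exists N, t, (fun i => mkC01 (cp i)); split.
(* This counts the functions: there are more than [d^-1] of them, as the pigeonhole argument in
   [not_BSa_C01_dense] requires. *)
- by rewrite (le_lt_trans _ Nd)// lef_pV2 ?posrE// ler_nat.
- by move=> i s /=; rewrite divr_ge0// ltW.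
- by move=> s /=; rewrite -mulr_suml -[X in X * _]/(H s) divff// gt_eqF.
- move=> i j; rewrite -[LHS]/(h i (t j) / H (t j)) ht /H (bigD1 j)// ht eqxx.
  rewrite big1 => [|k kj]; first by rewrite [X in _ / X]addr0 divr1.
  by rewrite ht (negbTE kj).
- move=> i s; have -> : mkC01 (cp i) s = h i s / H s by [].
  rewrite mulf_eq0 negb_or => /andP[/hnz is1 _].
  have E : N%:R * `|val s - i%:R / N%:R| = `|N%:R * val s - i%:R|.
    by rewrite -{1}(ger0_norm (ltW N0)) -normrM mulrBr mulrCA divff ?gt_eqF// mulr1.
  rewrite (le_lt_trans _ Nd)// tE distrC -(ler_pM2l N0) divff ?gt_eqF//.
  by rewrite E ltW.
Qed.

Lemma clipCE (a b : R) x t : clipC a b x t = Num.max a (Num.min b (x t)).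
Proof. by []. Qed.

Lemma clipC_itv (a b : R) x t : a <= b -> a <= clipC a b x t <= b.
Proof. by move=> ab; rewrite clipCE le_max lexx/= ge_max ab ge_min lexx. Qed.

Lemma clipC_id (a b : R) x t : a <= x t <= b -> clipC a b x t = x t.
Proof. by rewrite clipCE => /andP[ax xb]; rewrite (min_idPr xb) (max_idPr ax). Qed.

Lemma bop_sumE (J : Type) (r : seq J) (P : pred J) (F : J -> bop (C01 R) R) x :
  (\sum_(i <- r | P i) F i) x = \sum_(i <- r | P i) F i x.
Proof. by elim/big_rec2: _ => // i u v _ <-. Qed.

Lemma C01_norm1 : `|cstC 1| = 1 :> R.
Proof.
apply/le_anti/andP; split; first by apply: C01_norm_le => t /=; rewrite normr1.
by rewrite (le_trans _ (C01_norm_ge _ (clamp01 0)))//= normr1.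
Qed.

(** * Finite combinations of point evaluations *)

Section interpolation.
Variables (N : nat) (t : 'I_N.+1 -> I) (p : 'I_N.+1 -> C01 R).
Hypothesis p0 : forall i s, 0 <= p i s.
Hypothesis p1 : forall s, \sum_i p i s = 1.
Hypothesis pt : forall i j, p i (t j) = (i == j)%:R.

Definition atomic (a : 'I_N.+1 -> R) : bop (C01 R) R := \sum_i a i *: delta (t i).

Lemma atomicE a x : atomic a x = \sum_i a i * x (t i).
Proof. by rewrite /atomic bop_sumE. Qed.

(** Continuity forbids changing [x] at the atoms only. Instead [x] is moved everywhere towards the
    interpolation [sg] of the signs, by at most [M], a multiple of the defect. At the atoms with
    nonzero weight the gap is at most [M], so [sg] is reached there; elsewhere the result lies
    between [x] and [sg], hence in the unit ball. *)
Lemma atomic_BSa a : BSa (C01 R) R (atomic a).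
Proof.
have [->|T0] := eqVneq (atomic a) 0; first exact: BSa0 C01_norm1.
pose sg : C01 R := \sum_i Num.sg (a i) *: p i.
have sgE s : sg s = \sum_i Num.sg (a i) * p i s by rewrite C01_sum.
have sgt i : sg (t i) = Num.sg (a i).
  rewrite sgE (bigD1 i)//= big1 => [|j ji]; last by rewrite pt (negbTE ji) mulr0.
  by rewrite pt eqxx mulr1 addr0.
have sg1 s : `|sg s| <= 1.
  rewrite sgE -[leRHS](p1 s) (le_trans (ler_norm_sum _ _ _))//; apply: ler_sum => i _.
  by rewrite normrM (ger0_norm (p0 _ _)) ler_piMl// normr_sg lern1 leq_b1.
have normT : `|atomic a| = \sum_i `|a i|.
  apply/le_anti/andP; split.
    apply: functional_norm_le => x x1; rewrite atomicE; apply: ler_sum => i _.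
    rewrite (le_trans (ler_norm _))// normrM ler_piMr//.
    exact: le_trans (C01_norm_ge _ _) x1.
  have : `|atomic a sg| <= `|atomic a| by apply: bop_le; apply: C01_norm_le.
  apply: le_trans; rewrite (le_trans _ (ler_norm _))// atomicE; apply: ler_sum => i _.
  by rewrite sgt mulrC -normrEsg.
have [m m0 mle] : exists2 m, 0 < m & forall i, i \in [seq i <- enum 'I_N.+1 | a i != 0] -> m <= `|a i|.
  by apply: seq_norm_gt0 => i; rewrite mem_filter => /andP[].
have {}mle i : a i != 0 -> m <= `|a i| by move=> ai; apply: mle; rewrite mem_filter ai mem_enum.
have [i0 ai0] : exists i, a i != 0.
  apply: contrapT => a0; case/eqP: T0; apply/val_inj/funext => x /=.
  rewrite -[LHS]/(atomic a x) atomicE big1// => i _.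
  by have [->|ai] := eqVneq (a i) 0; rewrite ?mul0r//; case: a0; exists i.
apply: (@linear_exposing_BSa _ _ _ m^-1); rewrite ?invr_gt0// => x x1.
have xt s : `|x s| <= 1 by apply: le_trans (C01_norm_ge _ _) x1.
pose M := m^-1 * (`|atomic a| - atomic a x).
have pos i : 0 <= `|a i| - a i * x (t i).
  by rewrite subr_ge0 (le_trans (ler_norm _))// normrM ler_piMr.
have ME : M = m^-1 * \sum_i (`|a i| - a i * x (t i)).
  by rewrite sumrB -normT -atomicE.
have M0 : 0 <= M by rewrite ME mulr_ge0 ?invr_ge0 ?(ltW m0)// sumr_ge0.
have MN : - M <= M by rewrite ge0_cp.
have Mt i : a i != 0 -> `|(sg - x) (t i)| <= M.
  move=> ai; rewrite ME mulrC ler_pdivlMr// C01B sgt mulrC.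
  rewrite (le_trans (ler_wpM2r _ (mle _ ai)))// -normrM mulrBr (mulrC (a i)) -normrEsg.
  by rewrite (ger0_norm (pos i)) (bigD1 i)//= lerDl sumr_ge0.
pose y := x + clipC (- M) M (sg - x).
have yE i : a i != 0 -> y (t i) = Num.sg (a i).
  by move=> ai; rewrite C01D clipC_id -?ler_norml ?Mt// C01B sgt subrKC.
have y1 : `|y| <= 1.
  apply: C01_norm_le => s; rewrite C01D.
  have /andP[ym yM] := clipC_itv (sg - x) s MN.
  have := xt s; have := sg1 s; rewrite !ler_norml => /andP[? ?] /andP[? ?].
  have [sx|sx] := leP 0 ((sg - x) s).
    have : 0 <= clipC (- M) M (sg - x) s <= (sg - x) s.
      rewrite clipCE; apply/andP; split; first by rewrite le_max le_min M0 sx orbT.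
      by rewrite ge_max ge_min lexx orbT andbT (le_trans _ sx)// oppr_le0.
    by rewrite C01B => /andP[? ?]; lra.
  have : (sg - x) s <= clipC (- M) M (sg - x) s <= 0.
    rewrite clipCE; apply/andP; split; last first.
      by rewrite ge_max oppr_le0 M0 ge_min (ltW sx) orbT.
    by rewrite le_max le_min lexx (le_trans (ltW sx) M0) orbT.
  by rewrite C01B => /andP[? ?]; lra.
exists y; split.
- apply/le_anti; rewrite y1/= (le_trans _ (C01_norm_ge _ (t i0)))//.
  by rewrite yE// normr_sg ai0.
- rewrite normT atomicE; apply: eq_bigr => i _.
  have [->|ai] := eqVneq (a i) 0; first by rewrite mul0r normr0.
  by rewrite yE// mulrC -normrEsg.
- rewrite /y addrC addKr; apply: C01_norm_le => s.
  by rewrite ler_norml clipC_itv.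
Qed.

End interpolation.

Lemma weak_star_dense (A : set (bop (C01 R) R)) :
  (forall T, exists2 T_ : nat -> bop (C01 R) R, (forall n, A (T_ n)) &
    forall x, T_ n x @[n --> \oo] --> T x) ->
  dense (A : set (weak_star_dual (C01 R))).
Proof.
move=> AT O [T OT] [U oU UO]; have [T_ AT_ T_T] := AT T.
have cT : {ptws, (fun n => T_ n : C01 R -> R) @ \oo --> (T : C01 R -> R)}.
  by apply/pointwise_cvgP.
have UT : U (T : C01 R -> R) by rewrite -UO in OT.
have [n _ /(_ n (leqnn n)) Un] := cT _ (open_nbhs_nbhs (conj oU UT)).
by exists (T_ n); split; rewrite -?UO.
Qed.

(** With weights [T (p i)] at the nodes, the atomic functional evaluates [T] at the interpolant of
    [x] in the partition of unity, which is uniformly close to [x] on a fine grid. *)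
Lemma BSa_C01_dense : dense (BSa (C01 R) R : set (weak_star_dual (C01 R))).
Proof.
apply: weak_star_dense => T.
(* The approximant depends on the mesh alone; [x] enters afterwards, through its oscillation at that
   scale. *)
have /choice[T_ T_P] : forall n, exists S : bop (C01 R) R, BSa (C01 R) R S /\
    forall x e, (forall s t, `|val s - val t| < n.+1%:R^-1 -> `|x s - x t| <= e) ->
      `|T x - S x| <= `|T| * e.
  move=> n; have n0 : 0 < n.+1%:R^-1 :> R by rewrite invr_gt0.
  have [N [t [p [_ p0 p1 pt pd]]]] := C01_partition n0.
  exists (atomic t (fun i => T (p i))); split; first exact: atomic_BSa.
  move=> x e xe; rewrite atomicE.
  have -> : \sum_i T (p i) * x (t i) = T (\sum_i x (t i) *: p i).
    by rewrite linear_sum/=; apply: eq_bigr => i _; rewrite linearZ/= mulrC.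
  rewrite -linearB (le_trans (bop_ge _ _))// ler_wpM2l//; apply: C01_norm_le => s.
  rewrite C01B C01_sum -[x s]mul1r -[X in X * x s](p1 s) mulr_suml -sumrB.
  rewrite (le_trans (ler_norm_sum _ _ _))// -[leRHS]mul1r -[X in _ <= X * _](p1 s) mulr_suml.
  apply: ler_sum => i _; rewrite C01Z (mulrC (x _)) -mulrBr normrM (ger0_norm (p0 _ _)).
  have [->|pis] := eqVneq (p i s) 0; first by rewrite !mul0r.
  by rewrite ler_wpM2l// xe// distrC pd.
exists T_ => [n|x]; first by case: (T_P n).
apply/cvgrPdist_le => e e0.
have e1 : 0 < e / (`|T| + 1) by rewrite divr_gt0// ltr_wpDl.
have [d d0 xd] := C01_unif_continuous x e1.
near=> n; have [_ /(_ x (e / (`|T| + 1))) Tn] := T_P n.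
rewrite (le_trans (Tn _))//; last first.
  by rewrite mulrCA ger_pMr// ler_pdivrMr ?ltr_wpDl// mul1r lerDl.
move=> s t st; apply: xd; apply: lt_trans st _; near: n.
exists (Num.truncn d^-1) => // n /= dn.
rewrite invf_plt ?posrE// (lt_le_trans (truncnS_gt _))// ler_nat ltnS//.
Unshelve. all: by end_near. Qed.

End C01.

(** * Total variation of a functional on continuous functions *)

Section variation.
Context {R : realType}.
Implicit Types (x y : C01 R) (T : bop (C01 R) R).

Definition maxC0 x := maxC (cstC 0) x.

Let abs_le y x := forall s, `|y s| <= x s.

(** The integral of [x] against the total variation measure of [T], in its lattice form; meaningful
    for [x] nonnegative. *)
Definition variation T x : R := sup [set T y | y in [set y | abs_le y x]].

Let variation_has_ubound T x : has_ubound [set T y | y in [set y | abs_le y x]].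
Proof.
exists (`|T| * `|x|) => _ [y yx <-].
rewrite (le_trans (ler_norm _))// (le_trans (bop_ge _ _))// ler_wpM2l//.
apply: C01_norm_le => s; rewrite (le_trans (yx s))//.
by rewrite (le_trans (ler_norm _))// C01_norm_ge.
Qed.

Lemma variation_ge T x y : (forall s, `|y s| <= x s) -> T y <= variation T x.
Proof. by move=> yx; apply: ub_le_sup => //; exists y. Qed.

Lemma variation_le T x M : (forall s, 0 <= x s) ->
  (forall y, (forall s, `|y s| <= x s) -> T y <= M) -> variation T x <= M.
Proof.
move=> x0 TM; apply: ge_sup; last by move=> _ [y yx <-]; exact: TM.
by exists (T 0), 0 => // s; rewrite normr0.
Qed.

Lemma variation_ge0 T x : (forall s, 0 <= x s) -> 0 <= variation T x.
Proof. by move=> x0; rewrite -(linear0 T) variation_ge// => s; rewrite normr0. Qed.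

(* Riesz decomposition: if [|y| <= x1 + x2] then [y] clipped to [[- x1, x1]]
   leaves a remainder bounded by [x2]. *)
Lemma variationD T x1 x2 : (forall s, 0 <= x1 s) -> (forall s, 0 <= x2 s) ->
  variation T (x1 + x2) = variation T x1 + variation T x2.
Proof.
move=> x10 x20; apply/le_anti/andP; split.
  apply: variation_le => [s|y yx]; first by rewrite C01D addr_ge0.
  pose y1 := maxC (- x1) (minC x1 y).
  have y1E s : y1 s = Num.max (- x1 s) (Num.min (x1 s) (y s)) by [].
  rewrite -(subrKC y1 y) linearD lerD//; apply: variation_ge => s.
    rewrite y1E ler_norml le_max lexx/= ge_max ge_min lexx andbT.
    by rewrite (le_trans _ (x10 s))// oppr_le0.
  have := yx s; have := x10 s; have := x20 s; rewrite C01B C01D y1E !ler_norml.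
  move=> ? ? /andP[? ?]; rewrite /Num.max /Num.min.
  by case: ifPn; case: ifPn => ? ?; apply/andP; split; lra.
rewrite -lerBrDr; apply: variation_le => // y1 y1x.
rewrite lerBrDr -lerBrDl; apply: variation_le => // y2 y2x.
rewrite lerBrDl -linearD; apply: variation_ge => s.
by rewrite !C01D (le_trans (ler_normD _ _))// lerD.
Qed.

Lemma variationZ T (a : R) x : 0 <= a -> (forall s, 0 <= x s) ->
  variation T (a *: x) = a * variation T x.
Proof.
(* One inequality is enough: the other is the same one for the factor [a^-1] and the function
   [a *: x]. *)
move=> a0 x0; have le (b : R) (z : C01 R) : 0 < b -> (forall s, 0 <= z s) ->
    b * variation T z <= variation T (b *: z).
  move=> b0 z0; rewrite mulrC -ler_pdivlMr//; apply: variation_le => // y yz.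
  have bT : b * T y = T (b *: y) by rewrite linearZ.
  rewrite ler_pdivlMr// mulrC bT; apply: variation_ge => s.
  by rewrite !C01Z normrM (gtr0_norm b0) ler_pM2l.
move: a0; rewrite le_eqVlt => /predU1P[<-|a0].
  rewrite scale0r mul0r; apply/le_anti/andP; split; last exact: variation_ge0.
  apply: variation_le => // y y0; rewrite (_ : y = 0) ?linear0//.
  by apply: C01_ext => s; apply/eqP; rewrite -normr_le0 y0.
apply/le_anti; rewrite le// andbT.
have := le a^-1 (a *: x); rewrite scalerA mulVf ?gt_eqF// scale1r invr_gt0 => /(_ a0).
rewrite -(ler_pM2l a0) mulrA mulfV ?gt_eqF// mul1r; apply => s.
by rewrite C01Z mulr_ge0// ltW.
Qed.

Let pos_ge0 x s : 0 <= maxC0 x s.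
Proof. by rewrite /= le_max lexx. Qed.

Let posBneg x : maxC0 x - maxC0 (- x) = x.
Proof.
apply: C01_ext => s; rewrite C01B -[maxC0 x s]/(Num.max 0 (x s)).
rewrite -[maxC0 (- x) s]/(Num.max 0 (- x s)) /Num.max.
by case: ifPn; case: ifPn; rewrite ?oppr_gt0 -?leNgt => ? ?; lra.
Qed.

Definition variation_ext T x := variation T (maxC0 x) - variation T (maxC0 (- x)).

(** Additivity on the cone makes the extension independent of the chosen difference of nonnegative
    functions; linearity then only requires a convenient decomposition. *)
Let variation_extE T x (a b : C01 R) : (forall s, 0 <= a s) -> (forall s, 0 <= b s) ->
  x = a - b -> variation_ext T x = variation T a - variation T b.
Proof.
move=> a0 b0 xab.
have E : maxC0 x + b = a + maxC0 (- x).
  have -> : maxC0 x = x + maxC0 (- x) by rewrite -{2}(posBneg x) subrK.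
  by rewrite {1}xab addrAC subrK.
have := congr1 (variation T) E; rewrite !variationD// /variation_ext; lra.
Qed.

Lemma variation_ext_linear T : linear (variation_ext T).
Proof.
move=> a x y; have lin (b : R) (u v : C01 R) : 0 <= b ->
    (forall s, 0 <= u s) -> (forall s, 0 <= v s) ->
    (forall s, 0 <= (b *: u + v) s) /\
    variation T (b *: u + v) = b * variation T u + variation T v.
  move=> b0 u0 v0; have bu0 s : 0 <= (b *: u) s by rewrite C01Z mulr_ge0.
  by split=> [s|]; [rewrite C01D addr_ge0|rewrite (variationD _ bu0 v0) variationZ].
rewrite -[RHS]/(a * variation_ext T x + variation_ext T y).
have [a0|/ltW a0] := leP 0 a.
  have [P0 P] := lin a _ _ a0 (pos_ge0 x) (pos_ge0 y).
  have [N0 N] := lin a _ _ a0 (pos_ge0 (- x)) (pos_ge0 (- y)).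
  rewrite (variation_extE _ P0 N0); first by rewrite P N /variation_ext; ring.
  by rewrite opprD addrACA -scalerBr !posBneg.
(* A negative factor exchanges the roles of the positive and negative parts of [x]. *)
rewrite -oppr_ge0 in a0.
have [P0 P] := lin (- a) _ _ a0 (pos_ge0 (- x)) (pos_ge0 y).
have [N0 N] := lin (- a) _ _ a0 (pos_ge0 x) (pos_ge0 (- y)).
rewrite (variation_extE _ P0 N0); first by rewrite P N /variation_ext; ring.
by rewrite opprD addrACA -scalerBr posBneg -(opprB (maxC0 x)) posBneg scalerN scaleNr opprK.
Qed.

Lemma variation_ext_bound T x : `|variation_ext T x| <= `|T| * `|x|.
Proof.
have le z : (forall s, `|maxC0 z s| <= `|x|) -> 0 <= variation T (maxC0 z) <= `|T| * `|x|.
  move=> zx; apply/andP; split; first exact: variation_ge0.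
  apply: variation_le => // y yz.
  rewrite (le_trans (ler_norm _))// (le_trans (bop_ge _ _))// ler_wpM2l//.
  by apply: C01_norm_le => s; rewrite (le_trans (yz s))// (le_trans (ler_norm _)).
have /andP[p1 p2] : 0 <= variation T (maxC0 x) <= `|T| * `|x|.
  apply: le => s; rewrite ger0_norm// /= ge_max normr_ge0.
  by rewrite (le_trans (ler_norm _))// C01_norm_ge.
have /andP[n1 n2] : 0 <= variation T (maxC0 (- x)) <= `|T| * `|x|.
  apply: le => s; rewrite ger0_norm// /= ge_max normr_ge0.
  by rewrite C01N (le_trans (ler_norm _))// normrN C01_norm_ge.
by rewrite /variation_ext ler_norml; apply/andP; split; lra.
Qed.

Lemma variation_bop T : exists V : bop (C01 R) R,
  (forall x y, (forall s, `|y s| <= x s) -> T y <= V x) /\ `|V| <= `|T|.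
Proof.
exists (mkbop (@variation_ext_linear T) (@variation_ext_bound T)); split.
  move=> x y yx; rewrite -[leRHS]/(variation_ext T x) (@variation_extE _ _ x 0).
  - rewrite (_ : variation T 0 = 0) ?subr0; first exact: variation_ge.
    by rewrite -(scale0r 0) variationZ ?mul0r.
  - by move=> s; rewrite (le_trans _ (yx s)).
  - by [].
  - by rewrite subr0.
apply: bop_norm_le => x x1; rewrite (le_trans (variation_ext_bound _ _))//.
by rewrite ler_piMr.
Qed.

End variation.

(** * Masses accumulating at a point that is not charged *)

Section diffuse.
Context {R : realType}.
Local Notation I := (set_type (`[0 : R, 1]%classic : set R)).
Implicit Types (x : C01 R) (q : I).
Local Notation half := (2^-1 : R).

Let half1 : `|half| < 1.
Proof. by rewrite ger0_norm ?invr_ge0// invf_lt1// ltr1n. Qed.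

Let w : nat -> R := geometric half half.

Let w0 n : 0 < w n.
Proof. by rewrite /w /geometric/= mulr_gt0 ?exprn_gt0 ?invr_gt0. Qed.

(** The telescoping form puts partial sums and tails of the weights in closed form. *)
Let wE n : w n = half ^+ n - half ^+ n.+1.
Proof. by rewrite /w /geometric/= exprS; lra. Qed.

Let series_w n : series w n = 1 - half ^+ n.
Proof.
rewrite /series/=; elim: n => [|n IH]; first by rewrite big_geq// expr0 subrr.
by rewrite big_nat_recr//= IH wE; lra.
Qed.

Section points.
Variable qs : nat -> I.

Let term x n := w n * x (qs n).

Let term_norm x n : `|term x n| <= `|x| * w n.
Proof. by rewrite normrM (gtr0_norm (w0 n)) mulrC ler_wpM2r ?(ltW (w0 _))// C01_norm_ge. Qed.

Let series_term_norm x n : `|series (term x) n| <= `|x|.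
Proof.
rewrite (le_trans (ler_norm_sum _ _ _))//.
rewrite (@le_trans _ _ (\sum_(0 <= i < n) `|x| * w i))//.
  by apply: ler_sum => i _; exact: term_norm.
rewrite -mulr_sumr -[X in _ * X]/(series w n) series_w.
by rewrite ler_piMr// gerBl exprn_ge0// invr_ge0.
Qed.

Let term_cvg x : cvgn (series (term x)).
Proof.
apply: normed_cvg; apply: (@series_le_cvg _ _ (fun n => `|x| * w n)).
- by move=> n /=.
- by move=> n; rewrite mulr_ge0// ltW.
- exact: term_norm.
- rewrite (_ : (fun n => _) = geometric (`|x| * half) half).
    exact: is_cvg_geometric_series.
  by apply/funext => n; rewrite /w /geometric/= mulrA.
Qed.

Let weighted_sum x : R := limn (series (term x)).

Let weighted_sum_linear : linear weighted_sum.
Proof.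
move=> a x y; apply: cvg_lim => //.
have -> : series (term (a *: x + y)) = a *: series (term x) + series (term y).
  rewrite -seriesZ -seriesD; congr series; apply/funext => n.
  rewrite -[RHS]/(a * term x n + term y n) /term C01D C01Z; ring.
by apply: cvgD; [apply: cvgZr|]; exact: term_cvg.
Qed.

Let weighted_sum_bound x : `|weighted_sum x| <= 1 * `|x|.
Proof.
rewrite mul1r ler_norml; apply/andP; split.
  apply: limr_ge => //; apply: nearW => n.
  by have := series_term_norm x n; rewrite ler_norml => /andP[].
apply: limr_le => //; apply: nearW => n.
by have := series_term_norm x n; rewrite ler_norml => /andP[].
Qed.

Definition weighted_deltas : bop (C01 R) R :=
  mkbop weighted_sum_linear weighted_sum_bound.

Lemma weighted_deltas_norm : `|weighted_deltas| <= 1.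
Proof.
apply: bop_norm_le => x x1; rewrite (le_trans (weighted_sum_bound x))//.
by rewrite mul1r.
Qed.

Lemma weighted_deltas_ge x n : (forall s, 0 <= x s) ->
  w n * x (qs n) <= weighted_deltas x.
Proof.
move=> x0; have nd : nondecreasing_seq (series (term x)).
  by apply: nondecreasing_series => i _ _; rewrite mulr_ge0// ltW.
rewrite -[leRHS]/(limn (series (term x))).
have := nondecreasing_cvgn_le nd (term_cvg (x := x)) n.+1; apply: le_trans.
rewrite /series/= big_nat_recr//= lerDr sumr_ge0// => i _.
by rewrite mulr_ge0// ltW.
Qed.

(** Only the weights from index [n] on contribute, and they add up to [half ^+ n]. The [maxn] in the
    induction keeps the bound at zero during the first [n] vanishing terms. *)
Lemma weighted_deltas_le x n : (forall s, 0 <= x s <= 1) ->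
  (forall k, (k < n)%N -> x (qs k) = 0) -> weighted_deltas x <= half ^+ n.
Proof.
move=> x01 xn; rewrite -[leLHS]/(limn (series (term x))); apply: limr_le => //; apply: nearW => m.
suff : series (term x) m <= half ^+ n - half ^+ (maxn n m).
  by move=> /le_trans; apply; rewrite gerBl exprn_ge0// invr_ge0.
rewrite /series/=; elim: m => [|m IH]; first by rewrite big_geq// maxn0 subrr.
rewrite big_nat_recr// (le_trans (lerD IH (lexx _)))//.
have [mn|nm] := ltnP m n.
  by rewrite /term xn// mulr0 addr0 (maxn_idPl mn).
rewrite (maxn_idPr (leqW nm)).
have : term x m <= w m.
  by rewrite /term ler_piMr ?(ltW (w0 _))//; have /andP[] := x01 (qs m).
rewrite wE; lra.
Qed.

End points.

Lemma hat_subproof q (c : R) : continuous (fun s : I => Num.max 0 (1 - c * `|val s - val q|)).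
Proof.
move=> s; apply: (@continuous_max R I (cst 0) (fun s : I => 1 - c * `|val s - val q|)).
  exact: cst_continuous.
apply: continuousB; first exact: cst_continuous.
apply: continuousM; first exact: cst_continuous.
apply: (@continuous_comp _ _ _ _ (fun u : R => `|u|)); last exact: norm_continuous.
by apply: continuousB; [exact: val_continuous|exact: cst_continuous].
Qed.

Definition hat q c : C01 R := mkC01 (@hat_subproof q c).

Lemma hatE q c s : hat q c s = Num.max 0 (1 - c * `|val s - val q|).
Proof. by []. Qed.

(* The functional [sum_k 2^(-k-1) delta (q_k)] for a sequence of points
   [q_k <> q] converging to [q]. *)
Lemma diffuse_functional q : exists L : bop (C01 R) R,
  [/\ forall x, (forall s, 0 <= x s) -> 0 <= L x,
      forall x, (forall s, 0 <= x s) -> 0 < x q -> 0 < L x,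
      forall e, 0 < e -> exists phi : C01 R,
        [/\ forall s, 0 <= phi s <= 1, phi q = 1 & L phi <= e] &
      forall x, `|L x| <= `|x|].
Proof.
(* The points [qs n] approach [q] along the segment from the endpoint [c], so they stay in the
   interval even when [q] is itself an endpoint. *)
have [c [c0 c1 cq]] : exists c : R, [/\ 0 <= c, c <= 1 & c != val q].
  have [q0|q0] := eqVneq (val q) 0; last by exists 0; rewrite eq_sym.
  by exists 1; rewrite q0 oner_neq0.
have /andP[q0 q1] : 0 <= val q <= 1 by have := set_valP q; rewrite /= in_itv.
pose D := `|c - val q|; have D0 : 0 < D by rewrite normr_gt0 subr_eq0.
pose qs n := clamp01 (val q + (c - val q) / n.+1%:R).
have n0 n : 0 < n.+1%:R^-1 :> R by rewrite invr_gt0.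
have n1 n : n.+1%:R^-1 <= 1 :> R by rewrite invf_le1// ler1n.
have qsE n : val (qs n) = val q + (c - val q) / n.+1%:R.
  have : 0 <= val q + (c - val q) / n.+1%:R <= 1.
    by have := n0 n; have := n1 n; move: (n.+1%:R^-1) => r ? ?; apply/andP; split; nra.
  by move=> /andP[h1 h2]; rewrite /= (min_idPr h2) (max_idPr h1).
have qsd n : `|val (qs n) - val q| = D / n.+1%:R.
  by rewrite qsE addrC addKr normrM (gtr0_norm (n0 n)).
have qsq : qs n @[n --> \oo] --> q.
  have qq : val q + (c - val q) / n.+1%:R @[n --> \oo] --> val q.
    rewrite -[X in _ --> X]addr0 -[X in _ --> _ + X](mulr0 (c - val q)).
    apply: cvgD; first exact: cvg_cst.
    by apply: cvgM; [exact: cvg_cst|exact: cvg_harmonic].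
  rewrite -[X in _ --> X]clamp01K; apply: cvg_comp qq _; exact: clamp01_continuous.
exists (weighted_deltas qs); split.
- move=> x x0; apply: le_trans (weighted_deltas_ge qs 0 x0).
  by rewrite mulr_ge0// ltW.
- move=> x x0 xq.
  have : x (qs n) @[n --> \oo] --> x q by apply: cvg_comp qsq _; exact: C01_cts.
  move=> /cvgr_gt/(_ _ xq)[n _ /(_ n (leqnn n)) xn].
  by rewrite (lt_le_trans _ (weighted_deltas_ge qs n x0))// mulr_gt0.
- move=> e e0; have := @cvg_geometric R 1 half half1.
  move=> /cvgr_lt/(_ _ e0)[n _ /(_ n (leqnn n))]; rewrite /= mul1r => ne.
  have nD : 0 < n.+1%:R / D by rewrite divr_gt0.
  (* This slope makes the hat vanish at distance [D / n.+1] from [q] and beyond, in particular at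
     [qs k] for [k < n]. *)
  exists (hat q (n.+1%:R / D)); split.
  + by move=> s; rewrite hatE le_max lexx/= ge_max ler01 gerBl mulr_ge0// ltW.
  + by rewrite hatE subrr normr0 mulr0 subr0 (max_idPr _).
  + rewrite (le_trans _ (ltW ne))//; apply: weighted_deltas_le.
      by move=> s; rewrite hatE le_max lexx/= ge_max ler01 gerBl mulr_ge0// ltW.
    move=> k kn; rewrite hatE qsd.
    rewrite (max_idPl _)// subr_le0 mulrA divfK ?gt_eqF// ler_pdivlMr// mul1r ler_nat.
    exact: leqW.
- by move=> x; rewrite (le_trans (bop_ge _ _))// ler_piMl// weighted_deltas_norm.
Qed.

End diffuse.

(** * Norm attaining functionals on [C01] outside [BSa] *)

Section C01_not_BSa.
Context {R : realType}.
Local Notation I := (set_type (`[0 : R, 1]%classic : set R)).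
Implicit Types (x y f : C01 R) (T L P : bop (C01 R) R).

Lemma mulCE x y s : mulC x y s = x s * y s. Proof. by []. Qed.

Lemma cstCE (a : R) s : cstC a s = a. Proof. by []. Qed.

Lemma mulC_norm x y : `|mulC x y| <= `|x| * `|y|.
Proof. by apply: C01_norm_le => s; rewrite mulCE normrM ler_pM// C01_norm_ge. Qed.

Lemma bop_mulC_subproof L f : linear (fun x => L (mulC f x)).
Proof.
move=> a x y; have -> : mulC f (a *: x + y) = a *: mulC f x + mulC f y.
  by apply: C01_ext => s; rewrite C01D C01Z !mulCE C01D C01Z; ring.
by rewrite linearP.
Qed.

Lemma bop_mulC_bound L f x : `|L (mulC f x)| <= (`|L| * `|f|) * `|x|.
Proof. by rewrite (le_trans (bop_ge _ _))// -mulrA ler_wpM2l// mulC_norm. Qed.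

(** In terms of measures, [L] multiplied by the density [f]. *)
Definition bop_mulC L f : bop (C01 R) R :=
  mkbop (@bop_mulC_subproof L f) (@bop_mulC_bound L f).

Definition positive L := forall x, (forall s, 0 <= x s) -> 0 <= L x.

Lemma positive_mono L x y : positive L -> (forall s, x s <= y s) -> L x <= L y.
Proof. by move=> L0 xy; rewrite -subr_ge0 -linearB L0// => s; rewrite C01B subr_ge0. Qed.

Lemma positive_mulC L f x : positive L -> (forall s, 0 <= f s) -> `|x| <= 1 ->
  `|L (mulC f x)| <= L f.
Proof.
move=> L0 f0 x1; have xs s : - 1 <= x s <= 1.
  by rewrite -ler_norml (le_trans (C01_norm_ge _ _)).
rewrite ler_norml -linearN; apply/andP; split; apply: positive_mono => // s;
  rewrite ?C01N mulCE; have := f0 s; have := xs s => /andP[? ?] ?; nra.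
Qed.

(** Jordan decomposition: half the sum and half the difference of the variation [V] and [T]. The
    total mass of the two parts is [V] at the constant one. *)
Lemma positive_decomposition T : exists P N : bop (C01 R) R,
  [/\ positive P, positive N, forall x, T x = P x - N x &
      P (cstC 1) + N (cstC 1) <= `|T|].
Proof.
have [V [VT Vn]] := variation_bop T.
have abs_le x : (forall s, 0 <= x s) -> - V x <= T x <= V x.
  move=> x0; rewrite lerNl -linearN; apply/andP; split; apply: VT => s.
    by rewrite C01N normrN ger0_norm.
  by rewrite ger0_norm.
exists (2^-1 *: (V + T)), (2^-1 *: (V - T)); split.
- move=> x x0; rewrite -[X in _ <= X]/(2^-1 * (V x + T x)).
  by have /andP[? ?] := abs_le x x0; lra.
- move=> x x0; rewrite -[X in _ <= X]/(2^-1 * (V x - T x)).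
  by have /andP[? ?] := abs_le x x0; lra.
- by move=> x; rewrite -[RHS]/(2^-1 * (V x + T x) - 2^-1 * (V x - T x)); lra.
- have V1 : V (cstC 1) <= `|T|.
    by rewrite (le_trans (ler_norm _))// (le_trans (bop_le V _))// C01_norm1.
  by rewrite -[leLHS]/(2^-1 * (V _ + T _) + 2^-1 * (V _ - T _)); lra.
Qed.

Let clip (a b z : R) := Num.max a (Num.min b z).

Lemma clip_cases a b z : a <= b ->
  [\/ z <= a /\ clip a b z = a, a <= z /\ z <= b /\ clip a b z = z |
      b <= z /\ clip a b z = b].
Proof.
move=> ab; rewrite /clip; have [za|az] := leP z a.
  by apply: Or31; split=> //; rewrite (min_idPr (le_trans za ab)) (max_idPl za).
have [zb|bz] := leP z b.
  by apply: Or32; rewrite (max_idPr (ltW az)) ltW.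
by apply: Or33; rewrite (max_idPr ab) ltW.
Qed.

(** Here [u] stands for a hat around [q] and [v] for [x0]. The cutoff [1 - chi] erases [phi] and
    [psi] where [u >= 1/4]; [theta] vanishes for [u <= 1/4] and is one for [u >= 1/2], and [w] lives
    where [u > 1/2]. Likewise [phi] lives where [v > 1/4] and [psi] where [v < -1/4], so [X] has the
    right sign on each support. The last bounds control the erased mass. Forms such as [4 * u - 0]
    match the functions built from [clipC] by conversion. *)
Lemma cutoff_pointwise (u v : R) : 0 <= u -> u <= 1 -> -1 <= v -> v <= 1 ->
  let chi := clip 0 1 (4 * u - 0) in
  let theta := clip 0 1 (4 * u - 1) in
  let w := clip 0 1 (1 * u - 2^-1) in
  let phi := clip 0 1 (4 * v - 1) * (1 - chi) in
  let psi := clip 0 1 ((- 4) * v - 1) * (1 - chi) in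
  let X := (1 - theta) * clip (-1) 1 (4 * v) + theta in
  [/\ [/\ 0 <= phi, 0 <= psi, 0 <= w <= 1, 0 <= theta <= 1 & -1 <= X <= 1],
      [/\ phi * X = phi, psi * X = - psi, w * X = w, phi * theta = 0 & psi * theta = 0] &
      [/\ phi <= 1, psi <= 1, 1 - phi <= 2 * (1 - v) + 4 * u &
          1 - psi <= 2 * (1 + v) + 4 * u]].
Proof.
move=> u0 u1 v0 v1 chi theta w.
have chi4 : 0 <= chi /\ chi <= 1 /\ chi <= 4 * u.
  by case: (@clip_cases 0 1 (4 * u - 0) ler01); rewrite -/chi; lra.
have th01 : 0 <= theta /\ theta <= 1.
  by case: (@clip_cases 0 1 (4 * u - 1) ler01); rewrite -/theta; lra.
have w01 : 0 <= w /\ w <= 1.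
  by case: (@clip_cases 0 1 (1 * u - 2^-1) ler01); rewrite -/w; lra.
have ct : chi = 1 \/ theta = 0 /\ w = 0.
  case: (@clip_cases 0 1 (4 * u - 0) ler01); rewrite -/chi; [|..|by left; lra];
    case: (@clip_cases 0 1 (4 * u - 1) ler01); rewrite -/theta;
    case: (@clip_cases 0 1 (1 * u - 2^-1) ler01); rewrite -/w => ? ? ?;
    (by right; lra) || (by left; lra) || lra.
have tw : w = 0 \/ theta = 1.
  case: (@clip_cases 0 1 (4 * u - 1) ler01); rewrite -/theta;
    case: (@clip_cases 0 1 (1 * u - 2^-1) ler01); rewrite -/w => ? ?;
    (by right; lra) || (by left; lra) || lra.
set f := clip 0 1 (4 * v - 1); set g := clip 0 1 (_ * v - 1).
set c := clip (-1) 1 (4 * v).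
have f01 : 0 <= f /\ f <= 1 /\ 1 - f <= 2 * (1 - v).
  by case: (@clip_cases 0 1 (4 * v - 1) ler01); rewrite -/f; lra.
have g01 : 0 <= g /\ g <= 1 /\ 1 - g <= 2 * (1 + v).
  by case: (@clip_cases 0 1 ((- 4) * v - 1) ler01); rewrite -/g; lra.
have m11 : -1 <= 1 :> R by lra.
have c11 : -1 <= c /\ c <= 1.
  by case: (@clip_cases (-1) 1 (4 * v) m11); rewrite -/c; lra.
have fc : f = 0 \/ c = 1.
  case: (@clip_cases 0 1 (4 * v - 1) ler01); rewrite -/f; [by left; lra|..];
    case: (@clip_cases (-1) 1 (4 * v) m11); rewrite -/c => ? ?;
    (by right; lra) || (by left; lra) || lra.
have gc : g = 0 \/ c = -1.
  case: (@clip_cases 0 1 ((- 4) * v - 1) ler01); rewrite -/g; [by left; lra|..];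
    case: (@clip_cases (-1) 1 (4 * v) m11); rewrite -/c => ? ?;
    (by right; lra) || (by left; lra) || lra.
move: chi theta w f g c chi4 th01 w01 ct tw f01 g01 c11 fc gc {m11}.
move=> chi theta w f g c [chi0 [chi1 chi4]] [th0 th1] [w0 w1] ct tw [f0 [f1 fv]] [g0 [g1 gv]] [c0 c1] fc gc.
have chiB : 0 <= 1 - chi by rewrite subr_ge0.
split; split.
- exact: mulr_ge0.
- exact: mulr_ge0.
- by rewrite w0.
- by rewrite th0.
- by apply/andP; split; nra.
- by case: ct => [->|[-> _]]; [ring|case: fc => ->; ring].
- by case: ct => [->|[-> _]]; [ring|case: gc => ->; ring].
- by case: tw => ->; ring.
- by case: ct => [->|[-> _]]; ring.
- by case: ct => [->|[-> _]]; ring.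
- by rewrite mulr_ile1// gerBl.
- by rewrite mulr_ile1// gerBl.
- by have : f * chi <= chi; [rewrite ler_piMl|rewrite mulrBr mulr1; lra].
- by have : g * chi <= chi; [rewrite ler_piMl|rewrite mulrBr mulr1; lra].
Qed.

(* [nu x = P (phi x) - N (psi x) + d L (w x)] attains its norm at [X], and every
   norming vector takes the value [1] or [-1] at [q] because [L] charges every
   neighbourhood of [q]; but [q] itself carries no mass, so [nu] is strongly
   orthogonal to [delta q]. *)
Lemma diffuse_not_BSa (P N L : bop (C01 R) R) (phi psi w X theta : C01 R) (d : R) (q : I) :
  positive P -> positive N -> positive L -> 0 < d ->
  (forall x, (forall s, 0 <= x s) -> 0 < x q -> 0 < L x) ->
  (forall e, 0 < e -> exists h : C01 R,
     [/\ forall s, 0 <= h s <= 1, h q = 1 & L h <= e]) ->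
  (forall s, 0 <= phi s) -> (forall s, 0 <= psi s) -> (forall s, 0 <= w s <= 1) ->
  (forall s, 0 <= theta s <= 1) -> 0 < w q -> theta q = 1 ->
  (forall s, -1 <= X s <= 1) -> X q = 1 ->
  (forall s, phi s * X s = phi s) -> (forall s, psi s * X s = - psi s) ->
  (forall s, w s * X s = w s) ->
  (forall s, phi s * theta s = 0) -> (forall s, psi s * theta s = 0) ->
  let nu := bop_mulC P phi - bop_mulC N psi + d *: bop_mulC L w in
  (NA (C01 R) R `\` BSa (C01 R) R) nu.
Proof.
move=> P0 N0 L0 d0 Lq Lh phi0 psi0 w01 th01 wq thq X11 Xq phiX psiX wX phith psith nu.
have nuE x : nu x = P (mulC phi x) - N (mulC psi x) + d * L (mulC w x) by [].
have w0 s : 0 <= w s by have /andP[] := w01 s.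
pose A := P phi + N psi + d * L w.
have X1 : `|X| <= 1 by apply: C01_norm_le => s; rewrite ler_norml X11.
have nuX : nu X = A.
  rewrite nuE (_ : mulC phi X = phi); last exact: C01_ext.
  rewrite (_ : mulC psi X = - psi); last exact: C01_ext.
  rewrite (_ : mulC w X = w); last exact: C01_ext.
  by rewrite linearN opprK.
have nu_norm : `|nu| = A.
  apply/le_anti/andP; split; last first.
    by rewrite -nuX (le_trans (ler_norm _))// bop_le.
  apply: functional_norm_le => x x1; rewrite nuE.
  have := positive_mulC P0 phi0 x1; have := positive_mulC N0 psi0 x1.
  have := positive_mulC L0 w0 x1; rewrite !ler_norml => /andP[_ l] /andP[n _] /andP[_ p].
  by rewrite /A; have := ler_wpM2l (ltW d0) l; lra.
have Lw : 0 < L w by exact: Lq.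
have A0 : 0 < A.
  by rewrite /A ltr_wpDl ?mulr_gt0// addr_ge0 ?P0 ?N0.
(* If [x q < 1], the nonnegative function [w - w x] is positive at [q], so the [L] term falls
   strictly short of its maximum, and the other two terms cannot compensate. *)
have face x : `|x| <= 1 -> nu x = A -> x q = 1.
  move=> x1 nux; have xs s : - 1 <= x s <= 1.
    by rewrite -ler_norml (le_trans (C01_norm_ge _ _)).
  apply: contrapT => xq.
  have : 0 < L (w - mulC w x).
    apply: Lq => [s|].
      by rewrite C01B mulCE; have := w0 s; have /andP[] := xs s; nra.
    rewrite C01B mulCE -{1}(mulr1 (w q)) -mulrBr mulr_gt0// subr_gt0 lt_neqAle.
    by have /andP[_ ->] := xs q; rewrite andbT; apply/eqP.
  rewrite linearB subr_gt0 -(ltr_pM2l d0) => Lwx.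
  have := positive_mulC P0 phi0 x1; have := positive_mulC N0 psi0 x1.
  move: nux; rewrite nuE /A !ler_norml => ? /andP[? _] /andP[_ ?]; lra.
have Xn : `|X| = 1.
  by apply/le_anti; rewrite X1/= -[leLHS]normr1 -{1}Xq C01_norm_ge.
split; first by exists X; split=> //; rewrite nuX nu_norm gtr0_norm.
case=> _ /(_ (delta q)) [|x [x1 nux]].
  move=> l; rewrite neq_lt => /orP[l0|l0]; rewrite nu_norm; last first.
    rewrite (@lt_le_trans _ _ `|(nu + l *: delta q) X|) ?bop_le//.
    rewrite (lt_le_trans _ (ler_norm _))//.
    by rewrite -[ltRHS]/(nu X + l * X q) nuX Xq mulr1 ltrDl.
  have e0 : 0 < - l / (4 * d) by rewrite divr_gt0 ?oppr_gt0// mulr_gt0.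
  have [h [h01 hq Lhe]] := Lh _ e0.
  (* For [l < 0] the sign of [X] is flipped at [q]. The factor [theta] confines the flip to where
     [phi] and [psi] vanish, so only the [L] term loses, by at most [- l / 2], against a gain of
     [- l] at [q]. *)
  pose y := mulC X (cstC 1 - 2 *: mulC h theta).
  have yE s : y s = X s * (1 - 2 * (h s * theta s)) by [].
  have y1 : `|y| <= 1.
    apply: C01_norm_le => s; rewrite yE normrM -[leRHS]mulr1 ler_pM//.
      by rewrite ler_norml X11.
    rewrite ler_norml; have /andP[? ?] := h01 s; have /andP[? ?] := th01 s.
    by apply/andP; split; nra.
  have yq : y q = -1 by rewrite yE Xq hq thq; ring.
  have nuy : nu y = A - 2 * d * L (mulC w (mulC h theta)).
    rewrite nuE (_ : mulC phi y = phi); last first.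
      apply: C01_ext => s; rewrite mulCE yE mulrA phiX mulrBr mulr1.
      by rewrite mulrCA (mulrCA (phi s)) phith !mulr0 subr0.
    rewrite (_ : mulC psi y = - psi); last first.
      apply: C01_ext => s; rewrite mulCE yE mulrA psiX mulrBr mulr1 C01N.
      by rewrite mulrCA mulNr (mulrCA (psi s)) psith mulr0 oppr0 !mulr0 subr0.
    rewrite (_ : mulC w y = w - 2 *: mulC w (mulC h theta)); last first.
      apply: C01_ext => s; rewrite mulCE yE mulrA wX C01B C01Z !mulCE; ring.
    rewrite linearN linearB linearZ/= -[2 *: _]/(2 * _) /A; ring.
  have Lwh : L (mulC w (mulC h theta)) <= - l / (4 * d).
    apply: le_trans Lhe; apply: positive_mono => // s; rewrite !mulCE.
    have /andP[? ?] := h01 s; have /andP[? ?] := th01 s; have /andP[? ?] := w01 s.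
    rewrite mulrCA ler_piMr// mulr_ile1//.
  rewrite (@lt_le_trans _ _ `|(nu + l *: delta q) y|) ?bop_le//.
  rewrite (lt_le_trans _ (ler_norm _))//.
  rewrite -[ltRHS]/(nu y + l * y q) nuy yq.
  have : 2 * d * L (mulC w (mulC h theta)) <= - l / 2.
    rewrite (_ : - l / 2 = 2 * d * (- l / (4 * d))); first by rewrite ler_pM2l// mulr_gt0.
    by field; rewrite gt_eqF.
  lra.
rewrite -[delta q x]/(x q) => /scalar_BJ_orth; rewrite -normr_eq0 nux nu_norm gt_eqF//.
move=> /(_ isT) xq.
have [nxA|nxA] := leP 0 (nu x).
  have /face : `|x| <= 1 by rewrite x1.
  by rewrite -nu_norm -nux ger0_norm// => /(_ erefl)/eqP; rewrite xq eq_sym oner_eq0.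
have /face : `|- x| <= 1 by rewrite normrN x1.
rewrite linearN -nu_norm -nux ltr0_norm// => /(_ erefl)/eqP.
by rewrite C01N xq oppr0 eq_sym oner_eq0.
Qed.

(** Since [x0] nearly attains the norm, [P] is nearly carried by the region where [x0] is close to
    one, and [N] by the region where it is close to minus one; restricting both to separated regions
    costs little. *)
Lemma not_BSa_C01_dense : dense (NA (C01 R) R `\` BSa (C01 R) R).
Proof.
apply: norm_dense => T e e0.
have [P [N [P0 N0 PN PN1]]] := positive_decomposition T.
(* The error splits as [2 * d] from the defect of [x0], [4 * d] from the mass under the hat [p i],
   and [d] from the term in [L]. *)
pose d := e / 7; have d0 : 0 < d by rewrite divr_gt0.
have [x0 x01 Tx0] := functional_near_norm T d0.
have defect : P (cstC 1 - x0) + N (cstC 1 + x0) <= d.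
  by move: Tx0; rewrite PN (linearB P) (linearD N); lra.
have x0s s : - 1 <= x0 s <= 1.
  by rewrite -ler_norml (le_trans (C01_norm_ge _ _)).
have [n [t [p [nd p0 p1 pt _]]]] := C01_partition (divr_gt0 d0 (ltr_wpDl (normr_ge0 T) ltr01)).
(* Pigeonhole: more than [(|T| + 1) / d] functions share a total mass of at most [|T|]. *)
have [i Vpi] : exists i, P (p i) + N (p i) <= d.
  apply: contrapT => Vp.
  have : \sum_(i < n.+1) d <= \sum_i (P (p i) + N (p i)).
    by apply: ler_sum => i _; rewrite leNgt; apply/negP => /ltW Vpi; apply: Vp; exists i.
  have -> : \sum_i (P (p i) + N (p i)) = P (cstC 1) + N (cstC 1).
    rewrite big_split/= -!linear_sum (_ : \sum_i p i = cstC 1)//.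
    by apply: C01_ext => s; rewrite C01_sum p1.
  rewrite sumr_const card_ord -mulr_natr => /le_trans/(_ PN1).
  apply/negP; rewrite -ltNge mulrC; move: nd.
  rewrite invf_plt ?posrE ?divr_gt0 ?ltr_wpDl// invf_div ltr_pdivrMr//; lra.
have pi1 s : p i s <= 1.
  by rewrite -[leRHS](p1 s) (bigD1 i)//= lerDl sumr_ge0.
have [L [L0 Lq Lh Ln]] := diffuse_functional (t i).
pose chi := clipC 0 1 (4 *: p i - cstC 0).
pose theta := clipC 0 1 (4 *: p i - cstC 1).
pose w := clipC 0 1 (1 *: p i - cstC 2^-1).
pose phi0 := clipC 0 1 (4 *: x0 - cstC 1).
pose psi0 := clipC 0 1 ((- 4) *: x0 - cstC 1).
pose phi := mulC phi0 (cstC 1 - chi).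
pose psi := mulC psi0 (cstC 1 - chi).
pose clip0 := clipC (-1) 1 (4 *: x0).
pose X := mulC (cstC 1 - theta) clip0 + theta.
have pw s := cutoff_pointwise (p0 i s) (pi1 s) (proj1 (andP (x0s s))) (proj2 (andP (x0s s))).
have {}pw s : [/\ [/\ 0 <= phi s, 0 <= psi s, 0 <= w s <= 1, 0 <= theta s <= 1 & -1 <= X s <= 1],
    [/\ phi s * X s = phi s, psi s * X s = - psi s, w s * X s = w s, phi s * theta s = 0 & psi s * theta s = 0] &
    [/\ phi s <= 1, psi s <= 1, 1 - phi s <= 2 * (1 - x0 s) + 4 * p i s &
          1 - psi s <= 2 * (1 + x0 s) + 4 * p i s]] by exact: pw.
have pii : p i (t i) = 1 by rewrite pt eqxx.
have thq : theta (t i) = 1.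
  rewrite -[LHS]/(Num.max 0 (Num.min 1 (4 * p i (t i) - 1))) pii mulr1.
  have E : 1 <= 4 - 1 :> R by lra.
  by rewrite (min_idPl E) (max_idPr ler01).
have wq : 0 < w (t i).
  rewrite -[ltRHS]/(Num.max 0 (Num.min 1 (1 * p i (t i) - 2^-1))) pii mul1r.
  by rewrite lt_max lt_min ltr01 subr_gt0 invf_lt1// ltr1n orbT.
have Xq : X (t i) = 1.
  by rewrite -[LHS]/((1 - theta (t i)) * clip0 (t i) + theta (t i)) thq subrr mul0r add0r.
exists (bop_mulC P phi - bop_mulC N psi + d *: bop_mulC L w).
  by apply: (diffuse_not_BSa P0 N0 L0 d0 Lq Lh (X := X) (theta := theta)) => // s; case: (pw s) => -[? ? ? ? ?] [? ? ? ? ?] [].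
have Pnear : P (cstC 1 - phi) <= 2 * P (cstC 1 - x0) + 4 * P (p i).
  have <- : P (2 *: (cstC 1 - x0) + 4 *: p i) = 2 * P (cstC 1 - x0) + 4 * P (p i).
    by rewrite linearD !linearZ.
  by apply: positive_mono => // s; case: (pw s) => _ _ [].
have Nnear : N (cstC 1 - psi) <= 2 * N (cstC 1 + x0) + 4 * N (p i).
  have <- : N (2 *: (cstC 1 + x0) + 4 *: p i) = 2 * N (cstC 1 + x0) + 4 * N (p i).
    by rewrite linearD !linearZ.
  by apply: positive_mono => // s; case: (pw s) => _ _ [].
have phi_le1 s : 0 <= (cstC 1 - phi) s.
  by rewrite C01B subr_ge0 cstCE; have [_ _ [h _ _ _]] := pw s; exact: h.
have psi_le1 s : 0 <= (cstC 1 - psi) s.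
  by rewrite C01B subr_ge0 cstCE; have [_ _ [_ h _ _]] := pw s; exact: h.
apply: functional_norm_le => x x1.
have Ex : T x - (P (mulC phi x) - N (mulC psi x) + d * L (mulC w x)) =
    P (mulC (cstC 1 - phi) x) - N (mulC (cstC 1 - psi) x) - d * L (mulC w x).
  have -> : mulC (cstC 1 - phi) x = x - mulC phi x.
    by apply: C01_ext => s; rewrite C01B !mulCE C01B mulrBl mul1r.
  have -> : mulC (cstC 1 - psi) x = x - mulC psi x.
    by apply: C01_ext => s; rewrite C01B !mulCE C01B mulrBl mul1r.
  by rewrite !(linearB P) !(linearB N) /= PN; ring.
rewrite -[leLHS]/(T x - (P (mulC phi x) - N (mulC psi x) + d * L (mulC w x))) Ex.
have := positive_mulC P0 phi_le1 x1; have := positive_mulC N0 psi_le1 x1.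
have Lwx : `|L (mulC w x)| <= 1.
  rewrite (le_trans (Ln _))// (le_trans (mulC_norm _ _))// mulr_ile1//.
  apply: C01_norm_le => s; case: (pw s) => -[_ _ /andP[? ?] _ _] _ _.
  by rewrite ger0_norm.
have : - (d * L (mulC w x)) <= d.
  by rewrite -mulrN ger_pMr//; move: Lwx; rewrite ler_norml lerNl => /andP[].
rewrite !ler_norml => ? /andP[? _] /andP[_ ?].
have : e = 7 * d by rewrite /d mulrC divfK.
lra.
Qed.

End C01_not_BSa.

(** * Integrable classes and functionals given by bounded densities *)

Section L1.
Context d (T : measurableType d) {R : realType} (mu : {finite_measure set T -> \bar R}).
Local Notation X := (LspaceType1 mu).
Local Notation integrable f := (mu.-integrable setT (EFin \o (f : T -> R))).
Local Notation "'\integral' f" := (\int[mu]_x (f : T -> R) x) (at level 10).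
Implicit Types (f g h : T -> R) (x y : X).

Lemma L1_integrable x : integrable x.
Proof. by apply/Lfun1_integrable; exact: Lspace_Lfun. Qed.

Lemma integrable_measurable f : integrable f -> measurable_fun setT f.
Proof. by move=> /(measurable_int mu)/measurable_EFinP. Qed.

Lemma toL1_subproof f : integrable f -> f \in Lfun mu 1.
Proof. by move=> /Lfun1_integrable. Qed.

(* The class of [f], with junk value [0] if [f] is not integrable. *)
Definition toL1 f : X :=
  if pselect (integrable f) is left fi
  then Lspace_class (Lfun_Sub (lexx 1%E) (toL1_subproof fi)) else 0.

Lemma toL1K f : integrable f -> ae_eq mu setT (toL1 f : T -> R) f.
Proof. by rewrite /toL1; case: pselect => // fi _; exact: Lfun_class_ae. Qed.

Lemma L1_ae_eqP x y : ae_eq mu setT (x : T -> R) y -> x = y.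
Proof. exact: Lspace_eqP. Qed.

Lemma L1D x y : ae_eq mu setT (x + y : X) ((x : T -> R) \+ y).
Proof. exact: Lfun_class_ae. Qed.

Lemma L1Z (a : R) x : ae_eq mu setT (a *: x : X) (fun t => a * x t).
Proof. exact: Lfun_class_ae. Qed.

Lemma Rintegral_ae_eq f g : measurable_fun setT f -> measurable_fun setT g ->
  ae_eq mu setT f g -> \integral f = \integral g.
Proof.
move=> mf mg fg; congr fine; apply: ae_eq_integral => //.
- exact/measurable_EFinP.
- exact/measurable_EFinP.
- by apply: filterS fg => t /= /[apply] ->.
Qed.

Lemma L1_normE x : `|x| = \integral (fun t => `|x t|).
Proof. by rewrite /Num.norm/= /Lspace_norm Lnorm1. Qed.

Lemma L1_norm_ae x f : measurable_fun setT f -> ae_eq mu setT (x : T -> R) f ->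
  `|x| = \integral (fun t => `|f t|).
Proof.
move=> mf xf; rewrite L1_normE; apply: Rintegral_ae_eq.
- by apply: measurableT_comp => //; exact: integrable_measurable (L1_integrable x).
- exact: measurableT_comp.
- by apply: filterS xf => t /= /[apply] ->.
Qed.

Lemma integrableD_real f g : integrable f -> integrable g -> integrable (f \+ g).
Proof. by move=> fi gi; have := integrableD measurableT fi gi. Qed.

Lemma integrableZ_real (a : R) f : integrable f -> integrable (fun t => a * f t).
Proof. by move=> fi; have := integrableZl measurableT a fi. Qed.

Lemma integrableB_real f g : integrable f -> integrable g -> integrable (f \- g).
Proof. by move=> fi gi; have := integrableB measurableT fi gi. Qed.

Lemma integrable_le f g : measurable_fun setT f -> integrable g ->
  (forall t, `|f t| <= `|g t|) -> integrable f.
Proof.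
move=> mf gi fg; apply: le_integrable gi => //; first exact/measurable_EFinP.
by move=> t _ /=; rewrite lee_fin.
Qed.

Lemma integrable_bounded f (M : R) : measurable_fun setT f -> (forall t, `|f t| <= M) ->
  integrable f.
Proof.
move=> mf fM; apply: (integrable_le (g := cst M)) => //.
  exact: finite_measure_integrable_cst.
by move=> t; rewrite (le_trans (fM t))// ler_norm.
Qed.

Lemma toL1_norm f : integrable f -> `|toL1 f| = \integral (fun t => `|f t|).
Proof. by move=> fi; apply: L1_norm_ae; [exact: integrable_measurable|exact: toL1K]. Qed.

Lemma toL1_linear (a : R) f g : integrable f -> integrable g ->
  toL1 (fun t => a * f t + g t) = a *: toL1 f + toL1 g.
Proof.
move=> fi gi; have fgi := integrableD_real (integrableZ_real a fi) gi.
apply: L1_ae_eqP; have zg := L1D (a *: toL1 f) (toL1 g).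
have [nz nf ng nfg] := And4 (L1Z a (toL1 f)) (toL1K fi) (toL1K gi) (toL1K fgi).
near=> t; have tT : setT t by [].
have -> : toL1 (fun t => a * f t + g t) t = a * f t + g t by move: tT; near: t; exact: nfg.
have -> : (a *: toL1 f + toL1 g : X) t = (a *: toL1 f : X) t + toL1 g t by move: tT; near: t; exact: zg.
have -> : (a *: toL1 f : X) t = a * toL1 f t by move: tT; near: t; exact: nz.
have -> : toL1 f t = f t by move: tT; near: t; exact: nf.
by have -> : toL1 g t = g t by move: tT; near: t; exact: ng.
Unshelve. all: by end_near. Qed.

Lemma toL1_repr x : toL1 x = x.
Proof. by apply: L1_ae_eqP; apply: toL1K; exact: L1_integrable. Qed.

Lemma toL1_sum (J : choiceType) (r : seq J) (a : J -> R) (f_ : J -> T -> R) :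
  (forall j, integrable (f_ j)) ->
  toL1 (fun t => \sum_(j <- r) a j * f_ j t) = \sum_(j <- r) a j *: toL1 (f_ j).
Proof.
move=> fi; have i0 : integrable (cst 0) by apply: (integrable_bounded (M := 0)) => // t; rewrite normr0.
(* Integrability is carried through the induction because [toL1] is additive only on integrable
   functions. *)
have [] : integrable (fun t => \sum_(j <- r) a j * f_ j t) /\
    toL1 (fun t => \sum_(j <- r) a j * f_ j t) = \sum_(j <- r) a j *: toL1 (f_ j); last by [].
elim: r => [|j r [IHi IH]].
  have -> : (fun t => \sum_(j <- [::]) a j * f_ j t) = cst 0 by apply/funext => t; rewrite big_nil.
  split=> //; rewrite big_nil; apply/eqP; rewrite -normr_eq0 toL1_norm//.
  have -> : \integral (fun t => `|(cst 0 : T -> R) t|) = \integral (cst 0).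
    by apply: eq_Rintegral => t _; rewrite normr0.
  by rewrite Rintegral_cst// mul0r.
have -> : (fun t => \sum_(j <- j :: r) a j * f_ j t) =
    (fun t => a j * f_ j t + \sum_(j <- r) a j * f_ j t) by apply/funext => t; rewrite big_cons.
split; first by apply: integrableD_real => //; exact: integrableZ_real.
by rewrite toL1_linear// big_cons IH.
Qed.

Section functional.
Variables (g : T -> R) (M : R).
Hypotheses (mg : measurable_fun setT g) (gM : forall t, `|g t| <= M).

Lemma integrable_mul f : integrable f -> integrable (fun t => f t * g t).
Proof.
move=> fi; apply: (integrable_le (g := fun t => M * f t)).
- by apply: measurable_funM => //; exact: integrable_measurable.
- exact: integrableZ_real.
- move=> t; rewrite !normrM mulrC ler_wpM2r// (le_trans (gM t))// ler_norm//.
Qed.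

Lemma integral_mul_linear : linear (fun x : X => \integral (fun t => x t * g t)).
Proof.
move=> a x y; have xi := L1_integrable x; have yi := L1_integrable y.
rewrite -[RHS]/(a * _ + _) -RintegralZl//; last exact: integrable_mul.
rewrite -RintegralD//; last 2 first.
- by apply: integrableZ_real; exact: integrable_mul.
- exact: integrable_mul.
apply: Rintegral_ae_eq.
- by apply: integrable_measurable; apply: integrable_mul; exact: L1_integrable.
- apply: integrable_measurable; apply: integrableD_real.
    by apply: integrableZ_real; exact: integrable_mul.
  exact: integrable_mul.
apply: filterS2 (L1D (a *: x) y) (L1Z a x) => t xy1 x1 _ /=.
by rewrite xy1//= x1// mulrDl mulrA.
Qed.

Lemma integral_mul_bound x : `|\integral (fun t => x t * g t)| <= M * `|x|.
Proof.
have xi := L1_integrable x; have xgi := integrable_mul xi.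
rewrite (le_trans (le_normr_Rintegral _ _))// L1_normE -RintegralZl//; last exact: integrable_norm.
apply: le_Rintegral => //; first exact: integrable_norm.
  by apply: integrableZ_real; exact: integrable_norm.
by move=> t _; rewrite normrM mulrC ler_wpM2r.
Qed.

Definition L1_functional : bop X R := mkbop integral_mul_linear integral_mul_bound.

Lemma L1_functionalE x : L1_functional x = \integral (fun t => x t * g t).
Proof. by []. Qed.

Lemma L1_functional_toL1 f : integrable f ->
  L1_functional (toL1 f) = \integral (fun t => f t * g t).
Proof.
move=> fi; rewrite L1_functionalE; apply: Rintegral_ae_eq.
- by apply: integrable_measurable; apply: integrable_mul; exact: L1_integrable.
- by apply: integrable_measurable; exact: integrable_mul.
- by apply: filterS (toL1K fi) => t /= /[apply] ->.
Qed.

Lemma L1_functional_norm_le : 0 <= M -> `|L1_functional| <= M.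
Proof.
by move=> M0; apply: bop_norm_le => x x1; rewrite (le_trans (integral_mul_bound x))// ler_piMr.
Qed.

End functional.

Lemma Rintegral_indic A : measurable A -> \integral \1_A = fine (mu A).
Proof. by move=> mA; rewrite /Rintegral integral_indic// setIT. Qed.

Lemma Rintegral_indicM A g : measurable A -> \integral (fun t => \1_A t * g t) = \int[mu]_(t in A) g t.
Proof.
move=> mA; rewrite [RHS]Rintegral_mkcond; apply: eq_Rintegral => t _.
by rewrite patchE indicE; case: ifP => tA; rewrite ?mul1r ?mul0r.
Qed.

Lemma integrable_indicR A : measurable A -> integrable (\1_A).
Proof. exact: integrable_indic. Qed.

Lemma toL1_indic_norm A : measurable A -> `|toL1 \1_A| = fine (mu A).
Proof.
move=> mA; rewrite toL1_norm; last exact: integrable_indicR.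
rewrite -Rintegral_indic//; apply: eq_Rintegral => t _.
by rewrite ger0_norm.
Qed.

Lemma measurable_ltset f g : measurable_fun setT f -> measurable_fun setT g ->
  measurable [set t | f t < g t].
Proof.
move=> mf mg.
have -> : [set t | f t < g t] = setT `&` (fun t => f t < g t) @^-1` [set true].
  by rewrite setTI.
by apply: measurable_fun_ltr.
Qed.

Lemma Rintegral_le0_ae f : integrable f -> (forall t, 0 <= f t) -> \integral f <= 0 ->
  ae_eq mu setT f (cst 0).
Proof.
move=> fi f0 If.
have : (\int[mu]_t `|(f t)%:E| = 0)%E.
  have -> : (\int[mu]_t `|(f t)%:E| = \int[mu]_t (f t)%:E)%E.
    by apply: eq_integral => t _; rewrite gee0_abs// lee_fin.
  rewrite -[LHS]fineK; last exact: integrable_fin_num.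
  congr EFin; apply/le_anti; rewrite If/=; exact: Rintegral_ge0.
move/ae_eq_integral_abs => /(_ measurableT (measurable_int mu fi)).
by apply: filterS => t /= ft tT; have [] := ft tT.
Qed.

(** * Every functional on L1 has a bounded density *)

Section representation.
Import HBSimple.
Variable F : bop X R.

Definition L1_charge (A : set T) : \bar R :=
  if pselect (measurable A) then (F (toL1 \1_A))%:E else 0%E.

Lemma L1_chargeE A : measurable A -> L1_charge A = (F (toL1 \1_A))%:E.
Proof. by rewrite /L1_charge; case: pselect. Qed.

Lemma toL1_indicU A B : measurable A -> measurable B -> [disjoint A & B] ->
  toL1 \1_(A `|` B) = toL1 \1_A + toL1 \1_B.
Proof.
move=> mA mB AB; rewrite -[toL1 \1_A]scale1r -toL1_linear; [|exact: integrable_indicR..].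
congr toL1; apply/funext => t; rewrite mul1r !indicE in_setU.
have [tA|tA] := boolP (t \in A); have [tB|tB] := boolP (t \in B); rewrite ?addr0 ?add0r//=.
move: AB; rewrite disj_set2E => /eqP/seteqP[/(_ t) + _].
by move=> []; split; apply/set_mem.
Qed.

Lemma L1_charge0 : L1_charge set0 = 0%E.
Proof.
rewrite L1_chargeE// (_ : toL1 _ = 0) ?linear0//; apply/eqP; rewrite -normr_eq0.
by rewrite toL1_indic_norm// measure0.
Qed.

Lemma L1_charge_fin A : measurable A -> L1_charge A \is a fin_num.
Proof. by move=> mA; rewrite L1_chargeE. Qed.

(** Finite additivity reduces the claim to tails of the union, and [F] at the indicator of a tail is
    at most [|F|] times its measure, which tends to zero as [mu] is finite. *)
Lemma L1_charge_sigma_additive : semi_sigma_additive L1_charge.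
Proof.
move=> A mA tA mUA.
have mS n : measurable (\big[setU/set0]_(i < n) A i) by exact: bigsetU_measurable.
have sumE n : (\sum_(0 <= i < n) L1_charge (A i))%E =
    (F (toL1 \1_(\big[setU/set0]_(i < n) A i)))%:E.
  rewrite -L1_chargeE//; elim: n => [|n IH].
    by rewrite big_geq// big_ord0 L1_charge0.
  rewrite big_nat_recr//= IH big_ord_recr/= (L1_chargeE (mS n)) (L1_chargeE (mA n)).
  rewrite (L1_chargeE (measurableU _ _ (mS n) (mA n))) (toL1_indicU (mS n) (mA n)) ?linearD//.
  rewrite disj_set2E; apply/eqP; apply: (@trivIset_bigsetUI _ xpredT) => //.
  exact: sub_trivIset tA.
have tail n : fine (mu (\bigcup_k A k)) - \sum_(0 <= i < n) fine (mu (A i)) =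
    fine (mu (\bigcup_k A k `\` \big[setU/set0]_(i < n) A i)).
  have Ufin : (mu (\bigcup_k A k) < +oo)%E by rewrite -ge0_fin_numE// fin_num_measure.
  rewrite (measureD mUA (mS n) Ufin) (setIidr (@bigsetU_bigcup T A n)).
  rewrite fineB ?(fin_num_measure _ _ mUA) ?(fin_num_measure _ _ (mS n))//; congr (_ - _).
  rewrite measure_bigsetU// -[in RHS](big_mkord xpredT (fun i => mu (A i))) sum_fine// => i _.
  exact: fin_num_measure.
have mutail : fine (mu (\bigcup_k A k)) - \sum_(0 <= i < n) fine (mu (A i)) @[n --> \oo] --> (0 : R).
  rewrite -[X in _ --> X](subrr (fine (mu (\bigcup_k A k)))); apply: cvgB; first exact: cvg_cst.
  have := @measure_semi_sigma_additive _ _ _ mu A mA tA mUA.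
  rewrite -[X in _ --> X -> _]fineK ?fin_num_measure// => /fine_cvg.
  have -> // : fine \o (fun n => \sum_(0 <= i < n) mu (A i))%E =
      (fun n => \sum_(0 <= i < n) fine (mu (A i))).
  by apply/funext => n /=; rewrite sum_fine// => i _; exact: fin_num_measure.
rewrite (L1_chargeE mUA); under eq_fun do rewrite sumE.
apply: cvg_EFin; first by apply: nearW.
rewrite /= [X in X @ _](_ : _ = (fun n => F (toL1 \1_(\big[setU/set0]_(i < n) A i))))//.
apply/cvgrPdist_le => e e0.
have e1 : 0 < e / (`|F| + 1) by rewrite divr_gt0// ltr_wpDl.
move/cvgrPdist_le : mutail => /(_ _ e1); apply: filterS => n.
rewrite sub0r normrN tail => mue.
have -> : F (toL1 \1_(\bigcup_k A k)) - F (toL1 \1_(\big[setU/set0]_(i < n) A i)) =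
    F (toL1 \1_(\bigcup_k A k `\` \big[setU/set0]_(i < n) A i)).
  set S := \big[setU/set0]_(i < n) A i; set U := \bigcup_k A k.
  have -> : toL1 \1_U = toL1 \1_S + toL1 \1_(U `\` S).
    have SU : S `<=` U by exact: bigsetU_bigcup.
    rewrite -(toL1_indicU (mS n) (measurableD mUA (mS n))) ?setDUK//.
    by rewrite disj_set2E setDIK.
  by rewrite linearD addrC addKr.
rewrite (le_trans (bop_ge _ _))// toL1_indic_norm; last exact: measurableD.
rewrite (le_trans (ler_wpM2l _ (le_trans (ler_norm _) mue)))//.
by rewrite mulrCA ger_pMr// ler_pdivrMr ?ltr_wpDl// mul1r lerDl.
Qed.

HB.instance Definition _ := isCharge.Build _ _ _ L1_charge
  L1_charge0 L1_charge_fin L1_charge_sigma_additive.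

Lemma L1_charge_dominates : L1_charge `<< mu.
Proof.
apply/null_content_dominatesP => A mA A0; rewrite L1_chargeE//.
suff -> : toL1 \1_A = 0 by rewrite linear0.
by apply/eqP; rewrite -normr_eq0 toL1_indic_norm// A0.
Qed.

(* The Radon-Nikodym density of [A |-> F (toL1 \1_A)], clipped to
   [[- |F|, |F|]], which changes it only on a null set. *)
Lemma L1_indic_repr : exists g : T -> R,
  [/\ measurable_fun setT g, forall t, `|g t| <= `|F| &
      forall A, measurable A -> F (toL1 \1_A) = \int[mu]_(t in A) g t].
Proof.
have dom := L1_charge_dominates.
pose g0 := Radon_Nikodym L1_charge mu.
have g0i : mu.-integrable setT g0 := Radon_Nikodym_integrable dom.
have g0E A : measurable A -> L1_charge A = (\int[mu]_(t in A) g0 t)%E.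
  exact: Radon_Nikodym_integral dom.
pose g1 t := fine (g0 t).
have g01 t : g0 t = (g1 t)%:E by rewrite /g1 fineK//; exact: Radon_Nikodym_fin_num.
have g1i : integrable g1 by apply: eq_integrable g0i => // t _; rewrite g01.
have mg1 := integrable_measurable g1i.
have g1E A : measurable A -> F (toL1 \1_A) = \int[mu]_(t in A) g1 t.
  move=> mA; rewrite -[LHS]/(fine (F (toL1 \1_A))%:E) -L1_chargeE// g0E//.
  by congr fine; apply: eq_integral => t _; rewrite g01.
pose g t := Num.max (- `|F|) (Num.min `|F| (g1 t)).
have mg : measurable_fun setT g.
  apply: measurable_maxr; first exact: measurable_cst.
  by apply: measurable_minr => //; exact: measurable_cst.
have gF t : `|g t| <= `|F|.
  by rewrite ler_norml /g le_max lexx/= ge_max ge_min lexx andbT ge0_cp.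
have small (s : R) A : `|s| <= 1 -> measurable A ->
    s * \int[mu]_(t in A) g1 t <= `|F| * fine (mu A).
  move=> s1 mA; rewrite -g1E// (le_trans (ler_norm _))// normrM.
  rewrite (le_trans (ler_piMl _ s1))// (le_trans (bop_ge _ _))//.
  by rewrite toL1_indic_norm.
(* On the set [A] where the bound fails, [s * g1 - |F|] is positive, yet its integral over [A] is at
   most zero by [small]; so it vanishes almost everywhere. Taking [s] to be [1] and [-1] gives both
   sides. *)
have le_F (s : R) : `|s| <= 1 -> {ae mu, forall t, s * g1 t <= `|F|}.
  move=> s1; set A := [set t | `|F| < s * g1 t].
  have msg : measurable_fun setT (fun t => s * g1 t) by exact: measurable_funM.
  have mA : measurable A by exact: measurable_ltset.
  pose f t := \1_A t * (s * g1 t) - `|F| * \1_A t.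
  have i1 : integrable (fun t => \1_A t * (s * g1 t)).
    apply: (integrable_le (g := fun t => s * g1 t)); last 2 first.
    - exact: integrableZ_real.
    - by move=> t; rewrite normrM ler_piMl// indicE; case: (t \in A); rewrite ?normr1 ?normr0.
    by apply: measurable_funM.
  have i2 : integrable (fun t => `|F| * \1_A t) by apply: integrableZ_real; exact: integrable_indicR.
  have : ae_eq mu setT f (cst 0).
    apply: Rintegral_le0_ae; first exact: integrableB_real.
    - move=> t; rewrite /f indicE; have [tA|tA] := boolP (t \in A).
        by rewrite mul1r mulr1 subr_ge0; move/set_mem : tA => /ltW.
      by rewrite mul0r mulr0 subrr.
    - have E1 : \integral (fun t => \1_A t * (s * g1 t)) = s * \int[mu]_(t in A) g1 t.
        by rewrite Rintegral_indicM// RintegralZl//; apply: integrableS g1i.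
      have E2 : \integral (fun t => `|F| * \1_A t) = `|F| * fine (mu A).
        by rewrite RintegralZl ?Rintegral_indic//; exact: integrable_indicR.
      by rewrite RintegralB// E1 E2 subr_le0 small.
  apply: filterS => t /(_ Logic.I) ft; rewrite leNgt; apply/negP => Fs.
  move: ft; rewrite /f /= indicE mem_set// mul1r mulr1 => /eqP.
  by rewrite subr_eq0 gt_eqF.
exists g; split; [exact: mg|exact: gF|move=> A mA].
rewrite (g1E A mA) -(Rintegral_indicM g1 mA) -(Rintegral_indicM g mA).
apply: Rintegral_ae_eq.
- exact: measurable_funM.
- exact: measurable_funM.
- have n1 : `|1 : R| <= 1 by rewrite normr1.
  have n2 : `|-1 : R| <= 1 by rewrite normrN normr1.
  apply: filterS2 (le_F 1 n1) (le_F (-1) n2) => t; rewrite mul1r mulN1r => t1 t2 _.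
  by rewrite /g (min_idPr t1) (max_idPr _)// lerNl.
Qed.

(* By density of the simple functions it suffices to compare the two sides on
   indicators. *)
Lemma L1_repr : exists g : T -> R, exists (mg : measurable_fun setT g)
  (gF : forall t, `|g t| <= `|F|), F = L1_functional mg gF.
Proof.
have [g [mg gF gE]] := L1_indic_repr.
exists g, mg, gF; apply/val_inj/funext => x; set G := L1_functional mg gF.
have GE A : measurable A -> F (toL1 \1_A) = G (toL1 \1_A).
  move=> mA; rewrite gE// L1_functional_toL1 ?Rintegral_indicM//.
  exact: integrable_indicR.
have [H HE] : exists H : bop X R, forall y, H y = F y - G y by exists (F - G).
have sfunE (h : {sfun T >-> R}) : H (toL1 (fun t => h t)) = 0.
  have -> : toL1 (fun t => h t) = \sum_(r <- finmap.enum_fset (fset_set (range h))) r *: toL1 \1_(h @^-1` [set r]).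
    rewrite -toL1_sum; last by move=> r; exact: integrable_indicR.
    by congr toL1; apply/funext => t; rewrite fimfunE fsbig_finite.
  have mh r : measurable (h @^-1` [set r]) by exact: measurable_sfunP.
  rewrite linear_sum/= big1// => r _.
  have HZ a y : H (a *: y) = a * H y by rewrite linearZ.
  by rewrite HZ HE GE ?subrr ?mulr0//; exact: mh.
have [h_ [hi _ hx]] := approximation_sfun_integrable measurableT (L1_integrable x).
have near0 e : 0 < e -> exists h : {sfun T >-> R}, integrable (fun t => h t) /\ `|x - toL1 (fun t => h t)| <= e.
  move=> e0; move/fine_cvg : hx => /cvgrPdist_le/(_ _ e0)[n _ /(_ n (leqnn n))].
  rewrite sub0r normrN => /(le_trans (ler_norm _)) hn; exists (h_ n); split; first exact: hi.
  have -> : x - toL1 (fun t => h_ n t) = toL1 (fun t => -1 * h_ n t + x t).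
    rewrite toL1_linear; [|exact: hi|exact: L1_integrable].
    by rewrite scaleN1r addrC toL1_repr.
  rewrite toL1_norm; last first.
    by apply: integrableD_real (L1_integrable x); apply: integrableZ_real; exact: hi.
  apply: le_trans hn; rewrite /Rintegral le_eqVlt; apply/orP; left; apply/eqP.
  by congr fine; apply: eq_integral => t _; rewrite mulN1r addrC.
apply/eqP; rewrite -subr_eq0 -normr_le0; apply/ler_addgt0Pr => e e0; rewrite add0r.
have e1 : 0 < e / (`|H| + 1) by rewrite divr_gt0// ltr_wpDl.
have [h [ih xh]] := near0 _ e1.
rewrite -[X in `|X|]HE -[H x]subr0 -(sfunE h) -linearB.
rewrite (le_trans (bop_ge _ _))// (le_trans (ler_wpM2l _ xh))//.
by rewrite mulrCA ger_pMr// ler_pdivrMr ?ltr_wpDl// mul1r lerDl.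
Qed.

End representation.

End L1.

(** * Densities with and without a gap below their maximal modulus *)

Section L1_BSa.
Context d (T : measurableType d) {R : realType} (mu : {finite_measure set T -> \bar R}).
Local Notation X := (LspaceType1 mu).
Local Notation integrable f := (mu.-integrable setT (EFin \o (f : T -> R))).
Local Notation "'\integral' f" := (\int[mu]_x (f : T -> R) x) (at level 10).
Implicit Types (f g h k : T -> R) (x y : X) (A B E : set T).

Lemma fine_measure_gt0 A : measurable A -> (0 < mu A)%E -> 0 < fine (mu A).
Proof. by move=> mA A0; rewrite fine_gt0// A0/= -ge0_fin_numE// fin_num_measure. Qed.

Lemma measurable_indicR A : measurable A -> measurable_fun setT (\1_A : T -> R).
Proof. by move=> mA; exact: measurable_indic. Qed.

Lemma indic_cases A t : (A t /\ \1_A t = 1 :> R) \/ (~ A t /\ \1_A t = 0 :> R).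
Proof.
rewrite indicE; have [tA|tA] := boolP (t \in A); [left|right]; split=> //.
  exact/set_mem.
by move=> At; move/negP: tA; apply; exact/mem_set.
Qed.

Lemma eq_integral_ext f g : f =1 g -> \integral f = \integral g.
Proof. by move=> fg; apply: eq_Rintegral => t _. Qed.

(* Takes the value [1] where [g] vanishes. *)
Definition sign g : T -> R := fun t => 1 - 2 * \1_[set t | g t < 0] t.

Lemma sign_cases g t : (0 <= g t /\ sign g t = 1) \/ (g t < 0 /\ sign g t = -1).
Proof.
rewrite /sign; case: (indic_cases [set t | g t < 0] t) => -[/= gt ->]; [right|left].
  by split=> //; ring.
by split; [rewrite leNgt; apply/negP|ring].
Qed.

Lemma measurable_sign g : measurable_fun setT g -> measurable_fun setT (sign g).
Proof.
move=> mg; apply: measurable_funB; first exact: measurable_cst.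
apply: measurable_funM; first exact: measurable_cst.
by apply: measurable_indicR; apply: measurable_ltset => //; exact: measurable_cst.
Qed.

Lemma sign_sqr g t : sign g t * sign g t = 1.
Proof. by case: (sign_cases g t) => -[_ ->]; ring. Qed.

Lemma sign_norm g t : `|sign g t| = 1.
Proof. by case: (sign_cases g t) => -[_ ->]; rewrite ?normrN normr1. Qed.

Lemma signM g t : sign g t * g t = `|g t|.
Proof.
case: (sign_cases g t) => -[gt ->]; first by rewrite mul1r ger0_norm.
by rewrite mulN1r ltr0_norm.
Qed.

(* The witness is the normalized indicator of [B] twisted by [u]. *)
Lemma functional_norm_ge (F : bop X R) k (u : T -> R) (v : R) B :
  measurable B -> (0 < mu B)%E -> measurable_fun setT u -> (forall t, `|u t| = 1) ->
  integrable k ->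
  (forall f, integrable f -> (forall t, `|f t| <= (fine (mu B))^-1) ->
    F (toL1 mu f) = \integral (fun t => f t * k t)) ->
  (forall t, B t -> v <= u t * k t) -> exists x, `|x| = 1 /\ v <= F x.
Proof.
move=> mB B0 mu' u1 ki Fk vB; have m0 := fine_measure_gt0 mB B0; set m := fine (mu B) in m0 *.
pose f t := m^-1 * (\1_B t * u t).
have mf : measurable_fun setT f.
  apply: measurable_funM; first exact: measurable_cst.
  by apply: measurable_funM => //; exact: measurable_indicR.
have fn t : `|f t| = m^-1 * \1_B t.
  rewrite /f !normrM u1 mulr1 gtr0_norm ?invr_gt0//.
  by case: (indic_cases B t) => -[_ ->]; rewrite ?normr1 ?normr0.
have fm t : `|f t| <= m^-1.
  rewrite fn; case: (indic_cases B t) => -[_ ->]; rewrite ?mulr1// mulr0 invr_ge0.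
  exact: ltW.
have fi : integrable f by exact: integrable_bounded mf fm.
have iB := integrable_indicR mu mB.
exists (toL1 mu f); split.
  rewrite toL1_norm// (eq_integral_ext fn) RintegralZl// Rintegral_indic//.
  by rewrite mulVf// gt_eqF.
rewrite Fk//.
have -> : v = \integral (fun t => (m^-1 * v) * \1_B t).
  by rewrite RintegralZl// Rintegral_indic// mulrAC mulVf ?mul1r// gt_eqF.
apply: le_Rintegral => //.
- exact: integrableZ_real.
- have mk := integrable_measurable ki.
  apply: (integrable_le (g := fun t => m^-1 * k t)).
  + exact: measurable_funM.
  + exact: integrableZ_real.
  + by move=> t; rewrite normrM [leRHS]normrM ler_wpM2r// (le_trans (fm t))// ler_norm.
- move=> t _; rewrite /f; case: (indic_cases B t) => -[Bt ->]; last by rewrite !(mulr0, mul0r).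
  by rewrite mulr1 mul1r -mulrA ler_pM2l ?invr_gt0// vB.
Qed.

Section attained.
Variables (k : T -> R) (M : R) (A : set T).
Hypotheses (mk : measurable_fun setT k) (kM : forall t, `|k t| <= M) (M0 : 0 < M).
Hypotheses (mA : measurable A) (A0 : (0 < mu A)%E) (kA : forall t, A t -> `|k t| = M).
Local Notation F := (L1_functional mu mk kM).

Let ki : integrable k. Proof. exact: integrable_bounded mk kM. Qed.

Lemma L1_functional_attains : `|F| = M /\ exists x, `|x| = 1 /\ F x = M.
Proof.
have Fle : `|F| <= M by apply: L1_functional_norm_le; exact: ltW.
have [x [x1 Fx]] : exists x, `|x| = 1 /\ M <= F x.
  apply: (functional_norm_ge (k := k) (u := sign k)) mA A0 _ _ ki _ _.
  - exact: measurable_sign.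
  - exact: sign_norm.
  - by move=> f fi _; rewrite L1_functional_toL1.
  - by move=> t /kA <-; rewrite signM.
have FxF : F x <= `|F| by rewrite (le_trans (ler_norm _))// bop_le// x1.
split; first by apply/le_anti; rewrite Fle (le_trans Fx).
by exists x; split=> //; apply/le_anti; rewrite Fx (le_trans FxF).
Qed.

(** Let [a] be the mass of the part of [x] that sits on [A] with the sign of [k]. Keeping this part
    and spreading the missing mass [1 - a] over [A] gives a face point at distance at most
    [2 * (1 - a)], while the gap makes the defect at least [e * (1 - a)]; hence the constant
    [2 / e]. *)
Lemma gap_BSa (e : R) : 0 < e -> e <= M -> (forall t, ~ A t -> `|k t| <= M - e) ->
  BSa X R F.
Proof.
move=> e0 eM kgap; have [FM _] := L1_functional_attains.
have F0 : F != 0 by rewrite -normr_eq0 FM gt_eqF.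
apply: (linear_exposing_BSa (K := 2 / e) F0); first by rewrite divr_gt0.
move=> x x1; have xi := L1_integrable x; have mx := integrable_measurable xi.
have m0 := fine_measure_gt0 mA A0; set m := fine (mu A) in m0 *.
pose u t := sign k t.
have mu' : measurable_fun setT u by exact: measurable_sign.
pose p t := \1_A t * Num.max 0 (u t * x t).
have mp : measurable_fun setT p.
  apply: measurable_funM; first exact: measurable_indicR.
  apply: measurable_maxr; first exact: measurable_cst.
  exact: measurable_funM.
have p_cases t : (A t /\ \1_A t = 1 :> R /\ `|k t| = M /\ ((0 <= u t * x t /\ p t = u t * x t) \/
    (u t * x t < 0 /\ p t = 0))) \/ (\1_A t = 0 :> R /\ p t = 0 /\ `|k t| <= M - e).
  rewrite /p; case: (indic_cases A t) => -[At ->]; [left|right]; last first.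
    by rewrite mul0r kgap.
  rewrite kA// mul1r; do 3 split=> //; have [ux|ux] := leP 0 (u t * x t); [by left|by right].
have ux t : `|u t * x t| = `|x t| by rewrite normrM sign_norm mul1r.
have p0 t : 0 <= p t.
  by case: (p_cases t) => [[_ [_ [_ []]]]|[_ []]] => [[? ->]|[_ ->]|->].
have px t : p t <= `|x t|.
  case: (p_cases t) => [[_ [_ [_ []]]]|[_ []]] => [[? ->]|[_ ->]|->] //.
  by rewrite -ux ler_norm.
have ip : integrable p.
  by apply: (integrable_le mp xi) => t; rewrite ger0_norm.
have inx := integrable_norm xi : integrable (fun t => `|x t|).
have iA := integrable_indicR mu mA.
set a := \integral p; set n := `|x|.
have nE : n = \integral (fun t => `|x t|) by rewrite /n L1_normE.
have an : a <= n by rewrite nE; apply: le_Rintegral => //; exact: inx.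
(* Height of the uniform density on [A] that brings the norm back to one. *)
pose c := (1 - a) / m.
have c0 : 0 <= c by apply: divr_ge0; [rewrite subr_ge0 (le_trans an)|exact: ltW].
have cm : c * m = 1 - a by rewrite divfK// gt_eqF.
pose q t := p t + c * \1_A t.
have iq : integrable q by apply: integrableD_real => //; exact: integrableZ_real.
have Iq : \integral q = 1.
  rewrite RintegralD//; last exact: integrableZ_real.
  by rewrite RintegralZl// Rintegral_indic// cm; rewrite -/a; ring.
have A1 t : 0 <= \1_A t :> R by case: (indic_cases A t) => -[_ ->].
have q0 t : 0 <= q t by rewrite addr_ge0// mulr_ge0.
pose Y t := u t * q t.
have iY : integrable Y.
  apply: (integrable_le _ iq) => [|t]; last by rewrite normrM sign_norm mul1r.
  by apply: measurable_funM => //; exact: (integrable_measurable iq).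
have Yk t : Y t * k t = M * q t.
  rewrite /Y mulrAC signM; case: (p_cases t) => [[_ [_ [-> _]]]//|[A't [pt _]]].
  by rewrite /q A't pt mulr0 addr0 !mulr0.
exists (toL1 mu Y); split.
- rewrite toL1_norm// -[RHS]Iq; apply: eq_integral_ext => t.
  by rewrite normrM sign_norm mul1r ger0_norm.
- by rewrite FM L1_functional_toL1// (eq_integral_ext Yk) RintegralZl// Iq mulr1.
have dist : `|toL1 mu Y - x| <= n - a + (1 - a).
  have -> : toL1 mu Y - x = toL1 mu (fun t => -1 * x t + Y t).
    by rewrite toL1_linear// scaleN1r addrC toL1_repr.
  have iXY : integrable (fun t => -1 * x t + Y t).
    by apply: integrableD_real => //; exact: integrableZ_real.
  rewrite toL1_norm//.
  have -> : n - a + (1 - a) = \integral (fun t => (`|x t| - p t) + c * \1_A t).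
    rewrite RintegralD//; [|exact: integrableB_real|exact: integrableZ_real].
    by rewrite RintegralB// -nE -/a RintegralZl// Rintegral_indic// cm.
  apply: le_Rintegral => //; first exact: integrable_norm.
    by apply: integrableD_real; [exact: integrableB_real|exact: integrableZ_real].
  move=> t _.
  have -> : `|-1 * x t + Y t| = `|q t - u t * x t|.
    have -> : q t - u t * x t = u t * (Y t - x t) by rewrite mulrBr mulrA sign_sqr mul1r.
    by rewrite [RHS]normrM sign_norm [RHS]mul1r mulN1r addrC.
  rewrite /q addrAC; apply: (le_trans (ler_normD _ _)); apply: lerD; last first.
    by rewrite ger0_norm// mulr_ge0.
  case: (p_cases t) => [[_ [_ [_ []]]]|[_ []]] => [[h ->]|[h ->]|-> _].
  - by rewrite subrr normr0 -ux ger0_norm// subrr.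
  - by rewrite sub0r normrN ux subr0.
  - by rewrite sub0r normrN ux subr0.
(* Pointwise: outside [A] this is the gap, and on [A] where [x] has the wrong sign the product with
   [k] is negative. *)
have Fx : F x <= M * a + (M - e) * (n - a).
  rewrite L1_functionalE.
  have -> : M * a + (M - e) * (n - a) = \integral (fun t => M * p t + (M - e) * (`|x t| - p t)).
    rewrite RintegralD//; last 2 first.
    + exact: integrableZ_real.
    + by apply: integrableZ_real; exact: integrableB_real.
    rewrite RintegralZl// RintegralZl//; last exact: integrableB_real.
    by rewrite RintegralB// -nE.
  apply: le_Rintegral => //; first exact: (integrable_mul mk kM).
    by apply: integrableD_real; apply: integrableZ_real => //; exact: integrableB_real.
  move=> t _; have xk : x t * k t = (u t * x t) * `|k t|.
    by rewrite -signM -/(u t) mulrACA sign_sqr mul1r.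
  have := ux t; rewrite xk; have := px t.
  case: (p_cases t) => [[_ [_ [kt []]]]|[_ [pt kt]]].
  - by move=> [h ->] _; rewrite kt (ger0_norm h) => <-; rewrite subrr mulr0 addr0 mulrC.
  - move=> [h ->] _; rewrite kt (ltr0_norm h) => <-; rewrite mulr0 add0r subr0.
    rewrite mulrN mulrC -subr_le0 opprK -mulrDl.
    by rewrite mulr_ge0_le0 ?(ltW h)// addr_ge0 ?subr_ge0// ltW.
  - rewrite pt => _ <-; rewrite mulr0 add0r subr0 mulrC.
    rewrite (le_trans (ler_wpM2l (normr_ge0 _) (ler_norm _)))// ler_wpM2r//.
rewrite FM (le_trans dist)// mulrAC ler_pdivlMr//.
have Mn : (M - e) * (n - a) <= (M - e) * (1 - a) by rewrite ler_wpM2l ?subr_ge0// lerD2r.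
have : e * (1 - a) <= M - F x.
  have -> : e * (1 - a) = M - (M * a + (M - e) * (1 - a)) by ring.
  by rewrite lerD2l lerN2 (le_trans Fx)// lerD2l.
have : e * n <= e * 1 by rewrite ler_pM2l.
move: (F x) e0 => z; clear; lra.
Qed.

(** For [l > 0] the modulus of [k + l * h] grows on [A]; for [l < 0] it grows outside of [A], where
    [k] is almost extremal. A norming vector is carried by [A], where [h] has the sign of [k], so
    [S] is plus or minus one there. *)
Lemma no_gap_not_BSa : (forall t, ~ A t -> `|k t| < M) ->
  (forall e, 0 < e -> exists B, [/\ measurable B, (0 < mu B)%E &
     forall t, B t -> ~ A t /\ M - e <= `|k t|]) ->
  (NA X R `\` BSa X R) F.
Proof.
move=> kA' kB; have [FM [x0 [x01 Fx0]]] := L1_functional_attains.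
split; first by exists x0; split=> //; rewrite Fx0 FM gtr0_norm.
pose h t := sign k t * (2 * \1_A t - 1).
have mh : measurable_fun setT h.
  apply: measurable_funM; first exact: measurable_sign.
  apply: measurable_funB; last exact: measurable_cst.
  by apply: measurable_funM; [exact: measurable_cst|exact: measurable_indicR].
have h1 t : `|h t| <= 1.
  rewrite normrM sign_norm mul1r.
  case: (indic_cases A t) => -[_ ->]; first by rewrite mulr1 addrK normr1.
  by rewrite mulr0 sub0r normrN normr1.
have hi : integrable h by exact: integrable_bounded mh h1.
pose S := L1_functional mu mh h1.
have test (l v : R) B : measurable B -> (0 < mu B)%E ->
    (forall t, B t -> v <= sign k t * (k t + l * h t)) -> v <= `|F + l *: S|.
  move=> mB B0 vB.
  have [x [x1 vx]] : exists x, `|x| = 1 /\ v <= (F + l *: S) x.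
    apply: (functional_norm_ge (k := fun t => k t + l * h t) (u := sign k)) mB B0 _ _ _ _ _.
    - exact: measurable_sign.
    - exact: sign_norm.
    - by apply: integrableD_real => //; exact: integrableZ_real.
    - move=> f fi _; rewrite -[LHS]/(F (toL1 mu f) + l * S (toL1 mu f)).
      rewrite !L1_functional_toL1// -RintegralZl//; last exact: integrable_mul mh h1 _ fi.
      rewrite -RintegralD//; last 2 first.
      + exact: (integrable_mul mk kM).
      + by apply: integrableZ_real; exact: (integrable_mul mh h1).
      by apply: eq_integral_ext => t; ring.
    - exact: vB.
  by rewrite (le_trans vx)// (le_trans (ler_norm _))// bop_le// x1.
have signh t : sign k t * h t = 2 * \1_A t - 1 by rewrite mulrA sign_sqr mul1r.
have FS : strong_BJ_orth F S.
  move=> l; rewrite neq_lt FM => /orP[l0|l0].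
    (* Half of the gain [- l] pays for the distance of [k] to [M] on [B]; the other half makes the
       inequality strict. *)
    have l2 : 0 < - l / 2 by rewrite divr_gt0// oppr_gt0.
    have [B [mB B0 BA]] := kB _ l2.
    apply: (@lt_le_trans _ _ (M - (- l / 2) - l)); first by lra.
    apply: (test _ _ B) => // t /BA[At kt].
    rewrite mulrDr signM mulrCA signh.
    by case: (indic_cases A t) => -[// _ ->]; lra.
  apply: (@lt_le_trans _ _ (M + l)); first by rewrite ltrDl.
  apply: (test _ _ A) => // t At; rewrite mulrDr signM mulrCA signh kA//.
  by case: (indic_cases A t) => -[// _ ->]; lra.
move=> [_ /(_ S FS)[x [x1 Fx]]] /scalar_BJ_orth.
rewrite -normr_eq0 Fx FM gt_eqF// => /(_ isT) Sx.
have [y [y1 Fy Sy]] : exists y, [/\ `|y| = 1, F y = M & S y = 0].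
  have [F0|F0] := leP 0 (F x).
    by exists x; split=> //; move: Fx; rewrite FM ger0_norm.
  exists (- x); split; first by rewrite normrN.
    by rewrite linearN; move: Fx; rewrite FM ltr0_norm.
  have -> : S (- x) = - S x by rewrite linearN.
  by rewrite Sx oppr0.
have yi := L1_integrable y.
have iyk := integrable_mul mk kM yi; have iyh := integrable_mul mh h1 yi.
have iny := integrable_norm yi : integrable (fun t => `|y t|).
(* Equality case of the norm bound: it forces [y] to vanish where [|k| < M] and to share the sign of
   [k] elsewhere. *)
have ae : ae_eq mu setT (fun t => M * `|y t| - y t * k t) (cst 0).
  apply: Rintegral_le0_ae.
  - by apply: integrableB_real => //; exact: integrableZ_real.
  - move=> t; rewrite subr_ge0 (le_trans (ler_norm _))// normrM mulrC ler_wpM2r//.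
  - rewrite RintegralB//; last exact: integrableZ_real.
    have Iyk : \integral (fun t => y t * k t) = M by exact: Fy.
    by rewrite RintegralZl// -L1_normE y1 mulr1 Iyk subrr.
have : S y = `|y|.
  rewrite L1_normE -[LHS]/(\integral (fun t => y t * h t)); apply: Rintegral_ae_eq.
  - exact: (integrable_measurable iyh).
  - exact: (integrable_measurable iny).
  apply: filterS ae => t /(_ Logic.I)/eqP; rewrite subr_eq0 => /eqP yk _.
  have [->|yt] := eqVneq (y t) 0; first by rewrite mul0r normr0.
  case: (indic_cases A t) => -[At A1].
    have M1 : M != 0 by rewrite gt_eqF.
    have Mk : sign k t * k t = M by rewrite signM kA.
    apply: (mulfI M1); rewrite yk -Mk /h A1.
    have -> : sign k t * k t * (y t * (sign k t * (2 * 1 - 1))) =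
        (sign k t * sign k t) * (y t * k t) by ring.
    by rewrite sign_sqr mul1r.
  have : M * `|y t| <= `|y t| * `|k t| by rewrite yk -normrM ler_norm.
  by rewrite mulrC ler_pM2l ?normr_gt0// leNgt kA'.
by rewrite Sy y1 => /eqP; rewrite eq_sym oner_eq0.
Qed.

End attained.

End L1_BSa.

(** * Modifying a density where it is nearly extremal *)

Section L1_perturbation.
Context d (T : measurableType d) {R : realType} (mu : {finite_measure set T -> \bar R}).
Local Notation X := (LspaceType1 mu).
Hypothesis mu0 : (0 < mu setT)%E.
Variables (F : bop X R) (e : R).
Hypothesis e0 : 0 < e.

Lemma L1_functional_dist (g k : T -> R) (M N D : R)
  (mg : measurable_fun setT g) (gM : forall t, `|g t| <= M)
  (mk : measurable_fun setT k) (kN : forall t, `|k t| <= N) :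
  0 <= D -> (forall t, `|g t - k t| <= D) ->
  `|L1_functional mu mg gM - L1_functional mu mk kN| <= D.
Proof.
move=> D0 gkD; have mgk : measurable_fun setT (g \- k) by exact: measurable_funB.
apply: bop_norm_le => x x1; have xi := L1_integrable x.
have -> : (L1_functional mu mg gM - L1_functional mu mk kN) x = L1_functional mu mgk gkD x.
  rewrite -[LHS]/(\int[mu]_t (x t * g t) - \int[mu]_t (x t * k t)).
  rewrite -RintegralB//; last 2 first.
  - exact: (integrable_mul mg gM).
  - exact: (integrable_mul mk kN).
  by rewrite L1_functionalE; apply: eq_integral_ext => t /=; rewrite mulrBr.
by rewrite (le_trans (bop_le _ x1))// L1_functional_norm_le.
Qed.

(** If the set were null, cutting [g] to zero on it would represent the same [F] by a density
    bounded by [|F| - e]. *)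
Lemma L1_essential (g : T -> R) (mg : measurable_fun setT g) (gF : forall t, `|g t| <= `|F|) :
  F = L1_functional mu mg gF -> (0 < mu [set t | (`|F| - e < `|g t|)%R])%E.
Proof.
move=> Fg; set E := [set t | _].
have mE : measurable E.
  by apply: measurable_ltset; [exact: measurable_cst|exact: measurableT_comp].
rewrite lt_neqAle measure_ge0 andbT; apply/negP => /eqP/esym E0.
(* For [|F| < e] the bound [|F| - e] is negative and the set is the whole space, which has positive
   measure. *)
have [Fe|Fe] := ltP (`|F| - e) 0.
  have ET : E = setT by apply/seteqP; split=> // t _; rewrite /E/= (lt_le_trans Fe).
  by move: mu0; rewrite -ET E0 ltxx.
pose h t := (1 - \1_E t) * g t.
have mh : measurable_fun setT h.
  apply: measurable_funM => //; apply: measurable_funB; first exact: measurable_cst.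
  exact: measurable_indicR.
have hF t : `|h t| <= `|F| - e.
  rewrite /h; case: (indic_cases (R := R) E t) => -[Et ->]; first by rewrite subrr mul0r normr0.
  by rewrite subr0 mul1r leNgt; apply/negP.
have FH : `|F| <= `|F| - e.
  apply: bop_norm_le => x x1; have -> : F x = L1_functional mu mh hF x.
    rewrite {1}Fg !L1_functionalE; have xi := L1_integrable x; apply: Rintegral_ae_eq.
    - exact: (integrable_measurable (integrable_mul mg gF xi)).
    - exact: (integrable_measurable (integrable_mul mh hF xi)).
    exists E; split=> // t /= xgh; apply: contrapT => Et; apply: xgh => _.
    by rewrite /h; case: (indic_cases (R := R) E t) => -[// _ ->]; rewrite subr0 mul1r.
  by rewrite (le_trans (bop_le _ x1))// L1_functional_norm_le.
by move: FH; rewrite lerBrDl gerDr leNgt e0.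
Qed.

(* On the set [E] where the density [g] of [F] is nearly extremal, [g] is
   replaced by [sign g * (|F| + e - e * rho)]. *)
Lemma L1_perturbation : exists E : set T, [/\ measurable E, (0 < mu E)%E &
  forall rho : T -> R, measurable_fun setT rho -> (forall t, 0 <= rho t <= 1) ->
  exists k : T -> R, exists (mk : measurable_fun setT k) (kM : forall t, `|k t| <= `|F| + e),
  [/\ forall t, E t -> `|k t| = `|F| + e - e * rho t,
      forall t, ~ E t -> `|k t| <= `|F| - e &
      `|F - L1_functional mu mk kM| <= 2 * e]].
Proof.
have [g [mg [gF Fg]]] := L1_repr F.
have mE : measurable [set t | `|F| - e < `|g t|].
  by apply: measurable_ltset; [exact: measurable_cst|exact: measurableT_comp].
have E0 := L1_essential Fg.
set E := [set t | _] in mE E0; exists E; split=> // rho mrho rho01.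
have nF : 0 <= `|F| by [].
pose k t := \1_E t * (sign g t * (`|F| + e - e * rho t)) + (1 - \1_E t) * g t.
have mk : measurable_fun setT k.
  have mi := measurable_indicR mE (R := R).
  apply: measurable_funD; apply: measurable_funM => //.
    apply: measurable_funM; first exact: measurable_sign.
    apply: measurable_funB; first exact: measurable_cst.
    by apply: measurable_funM; first exact: measurable_cst.
  by apply: measurable_funB; first exact: measurable_cst.
have er t : 0 <= e * rho t /\ e * rho t <= e.
  by have /andP[r0 r1] := rho01 t; rewrite mulr_ge0 ?(ltW e0)//= ger_pMr.
have kE t : E t -> k t = sign g t * (`|F| + e - e * rho t).
  rewrite /k => Et; case: (indic_cases (R := R) E t) => -[// _ ->].
  by rewrite mul1r subrr mul0r addr0.
have kE' t : ~ E t -> k t = g t.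
  rewrite /k => Et; case: (indic_cases (R := R) E t) => -[// _ ->].
  by rewrite mul0r subr0 mul1r add0r.
have kEn t : E t -> `|k t| = `|F| + e - e * rho t.
  move=> /kE ->; rewrite normrM sign_norm mul1r ger0_norm//.
  by have [? ?] := er t; lra.
have kEn' t : ~ E t -> `|k t| <= `|F| - e.
  by move=> Et; rewrite kE'// leNgt; apply/negP.
have kM t : `|k t| <= `|F| + e.
  have [Et|Et] := pselect (E t); first by rewrite kEn//; have [? ?] := er t; lra.
  by have := kEn' _ Et; have := e0; lra.
exists k, mk, kM; split=> //; rewrite [X in `|X - _|]Fg.
apply: L1_functional_dist; first by rewrite mulr_ge0// ltW.
move=> t; have [Et|Et] := pselect (E t); last first.
  by rewrite kE'// subrr normr0 mulr_ge0// ltW.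
(* On [E] both functions have the same sign, [|g|] lies between [|F| - e] and [|F|], and [|k|]
   between [|F|] and [|F| + e]: hence the bound [2 * e]. *)
have -> : g t - k t = sign g t * (`|g t| - (`|F| + e - e * rho t)).
  by rewrite kE// [RHS]mulrBr -(signM g t) mulrA sign_sqr mul1r.
rewrite normrM sign_norm mul1r ler_norml.
have [? ?] := er t; have := gF t; move: Et; rewrite /E /= => ? ?.
by apply/andP; split; lra.
Qed.

(** With [rho = 0] the new modulus is constantly maximal on [E] and drops below [|F|] elsewhere,
    which leaves a gap. *)
Lemma L1_BSa_near : exists2 S : bop X R, BSa X R S & `|F - S| <= 2 * e.
Proof.
have [E [mE E0 /(_ (cst 0))]] := L1_perturbation.
case=> [||k [mk [kM [kE kE' FK]]]]; first exact: measurable_cst.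
  by move=> t; rewrite lexx/=.
have M0 : 0 < `|F| + e by rewrite ltr_wpDl.
exists (L1_functional mu mk kM) => //; apply: (gap_BSa mk kM M0 mE E0 _ e0).
- by move=> t /kE ->; rewrite mulr0 subr0.
- by rewrite lerDr.
- by move=> t /kE' /le_trans; apply; rewrite addrK lerBlDr lerDl ltW.
Qed.

End L1_perturbation.

(** * Lebesgue measure on the unit interval *)

Section L1_01.
Context {R : realType}.
Local Notation leb := (@lebesgue_measure R).
Local Notation m01 := (measurable_itv `[0 : R, 1] : measurable `[0 : R, 1]%classic).
Local Notation mu_ := (mrestr leb m01).

Lemma mrestr01_le A : measurable A -> (mu_ A <= leb A)%E.
Proof.
by move=> mA; rewrite /mrestr le_measure ?inE//; exact: measurableI.
Qed.

Lemma mrestr01_fin : fin_num_fun mu_.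
Proof.
move=> A mA; rewrite ge0_fin_numE; last exact: measure_ge0.
rewrite /mrestr; apply: (@le_lt_trans _ _ (leb `[0, 1]%classic)).
  by rewrite le_measure ?inE//; exact: measurableI.
by rewrite lebesgue_measure_itv/= lte_fin ltr01 oppr0 adde0 ltry.
Qed.

(** The measure underlying [L1_01], repackaged with its finiteness so that the results for finite
    measures apply to that space by conversion. *)
Definition lebesgue01 : {finite_measure set (measurableTypeR R) -> \bar R} :=
  HB.pack mu_ (Measure_isFinite.Build _ _ _ mu_ mrestr01_fin).

Lemma lebesgue01T : (0 < lebesgue01 setT)%E.
Proof.
rewrite -[lebesgue01 _]/(leb (setT `&` `[0, 1]%classic)) setTI.
by rewrite lebesgue_measure_itv/= lte_fin ltr01 oppr0 adde0 lte_fin ltr01.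
Qed.

Lemma lebesgue01_itv (a b : R) : a <= b -> fine (lebesgue01 `]a, b]%classic) <= b - a.
Proof.
move=> ab; rewrite -lee_fin fineK ?fin_num_measure//.
apply: le_trans (mrestr01_le _) _; first exact: measurable_itv.
rewrite lebesgue_measure_itv/= lte_fin; case: ifPn => // _.
by rewrite lee_fin subr_ge0.
Qed.

(* Nonatomicity: halving [E] at a point [c] beyond which it keeps positive
   measure arbitrarily close to [c]. *)
Lemma lebesgue01_split (E : set R) : measurable E -> (0 < lebesgue01 E)%E ->
  exists c : R, (0 < lebesgue01 (E `&` `]-oo, c]%classic))%E /\
    forall e : R, 0 < e -> (0 < lebesgue01 (E `&` `]c, (c + e)%R]%classic))%E.
Proof.
move=> mE E0.
pose phi t := fine (lebesgue01 (E `&` `]-oo, t]%classic)).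
have mEt t : measurable (E `&` `]-oo, t]%classic) by exact: measurableI.
have mEab a b : measurable (E `&` `]a, b]%classic) by exact: measurableI.
have fin A : measurable A -> lebesgue01 A \is a fin_num by exact: fin_num_measure.
have mono A B : measurable A -> measurable B -> A `<=` B ->
    fine (lebesgue01 A) <= fine (lebesgue01 B).
  move=> mA mB AB; apply: fine_le; [exact: fin|exact: fin|].
  by apply: le_measure => //; exact/mem_set.
have phiD a b : a <= b ->
    phi b <= phi a + fine (lebesgue01 (E `&` `]a, b]%classic)).
  move=> ab; rewrite -lee_fin EFinD (fineK (fin _ (mEt b))) (fineK (fin _ (mEt a))).
  rewrite (fineK (fin _ (mEab a b))).
  have -> : E `&` `]-oo, b]%classic = (E `&` `]-oo, a]%classic) `|` (E `&` `]a, b]%classic).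
    rewrite -setIUr; congr (_ `&` _); apply/seteqP; split=> t /=; rewrite !in_itv/=.
      by move=> tb; have [ta|ta] := leP t a; [left|right; rewrite tb].
    by move=> [/le_trans->//|/andP[]].
  apply: measureU2; [exact: mEt|exact: mEab].
have phiL a b : a <= b -> phi b <= phi a + (b - a).
  move=> ab; rewrite (le_trans (phiD _ _ ab))// lerD2l (le_trans _ (lebesgue01_itv ab))//.
  have mab : measurable `]a, b]%classic by [].
  by apply: (mono _ _ (mEab a b) mab) => t [].
pose m := fine (lebesgue01 E).
have m0 : 0 < m by exact: fine_measure_gt0.
have phi_neg : phi (-1) = 0.
  rewrite /phi (_ : lebesgue01 _ = 0%E)// -[LHS]/(leb (E `&` `]-oo, (-1)]%classic `&` `[0, 1]%classic)).
  rewrite -setIA (_ : _ `&` `[0, 1]%classic = set0) ?setI0 ?measure0//.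
  apply/seteqP; split=> t //=; rewrite !in_itv/= => -[t1 /andP[t0 _]].
  by move: (le_trans t0 t1); rewrite oppr_ge0 ler10.
have phi1 t : 1 <= t -> phi t = m.
  move=> t1; congr fine; rewrite -[LHS]/(leb (E `&` `]-oo, t]%classic `&` `[0, 1]%classic)).
  rewrite -[RHS]/(leb (E `&` `[0, 1]%classic)) -setIA; congr (leb (_ `&` _)).
  apply/seteqP; split=> r /=; rewrite !in_itv/=; first by case.
  by move=> /andP[r0 r1]; rewrite r0 r1; split=> //; exact: le_trans t1.
pose S := [set t | phi t <= m / 2].
have Sub : ubound S 1.
  move=> t St; rewrite leNgt; apply/negP => /ltW/phi1 tm.
  by move: St; rewrite /S/= tm leNgt ltr_pdivrMr// ltr_pMr// ltr1n.
have S1 : S (-1) by rewrite /S/= phi_neg divr_ge0// ltW.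
have supS : has_sup S by split; [exists (-1)|exists 1].
(* As [phi] grows at most as fast as the identity, it has no jump at [c]: its value there is exactly
   half of the mass, and it exceeds this half as soon as [c] is passed. *)
pose c := sup S.
have phic : phi c <= m / 2.
  apply/ler_addgt0Pr => e e0; have [t St ct] := sup_adherent e0 supS.
  have tc : t <= c by apply: ub_le_sup => //; exists 1.
  rewrite (le_trans (phiL _ _ tc))// lerD// lerBlDr -lerBlDl ltW//.
have phi_gt e : 0 < e -> m / 2 < phi (c + e).
  move=> e0; rewrite ltNge; apply/negP => ce.
  have : c + e <= c by apply: ub_le_sup => //; exists 1.
  by rewrite gerDl leNgt e0.
have phic' : m / 2 <= phi c.
  apply/ler_addgt0Pr => e e0; rewrite (le_trans (ltW (phi_gt e e0)))//.
  rewrite (le_trans (phiL c _ _)) ?lerDl ?(ltW e0)//.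
  by rewrite addrAC subrr add0r.
have pos A : measurable A -> 0 < fine (lebesgue01 A) -> (0 < lebesgue01 A)%E.
  by move=> mA; rewrite -lte_fin fineK ?fin.
exists c; split; first by apply: (pos _ (mEt c)); rewrite -[ltRHS]/(phi c) (lt_le_trans _ phic')// divr_gt0.
move=> e e0; apply: (pos _ (mEab c (c + e))).
have ce : c <= c + e by rewrite lerDl ltW.
by have := phiD _ _ ce; have := phi_gt e e0; lra.
Qed.

Lemma BSa_L1_dense : dense (BSa (L1_01 R) R).
Proof.
apply: norm_dense => F e e0; have e2 : 0 < e / 2 by rewrite divr_gt0.
have [S SB FS] := @L1_BSa_near _ _ _ lebesgue01 lebesgue01T F (e / 2) e2.
by exists S => //; rewrite (le_trans FS)// mulrC divfK.
Qed.

Lemma not_BSa_L1_dense : dense (NA (L1_01 R) R `\` BSa (L1_01 R) R).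
Proof.
apply: norm_dense => F e' e'0; pose e := e' / 2; have e0 : 0 < e by rewrite divr_gt0.
have [E [mE E0 pert]] := @L1_perturbation _ _ _ lebesgue01 lebesgue01T F e e0.
have [c [c0 cE]] := lebesgue01_split mE E0.
(* It vanishes up to [c] and is positive but arbitrarily small just beyond, so the modulus of [k] is
   maximal exactly on the part of [E] up to [c] and approaches its maximum from the right of [c]. *)
pose rho (t : R) := Num.max 0 (Num.min 1 (t - c)).
have mrho : measurable_fun setT rho.
  apply: measurable_maxr; first exact: measurable_cst.
  apply: measurable_minr; first exact: measurable_cst.
  by apply: measurable_funB; [exact: measurable_id|exact: measurable_cst].
have rho01 t : 0 <= rho t <= 1 by rewrite /rho le_max lexx/= ge_max ler01 ge_min lexx.
have [k [mk [kM [kE kE' FK]]]] := pert rho mrho rho01.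
exists (L1_functional lebesgue01 mk kM); last by rewrite (le_trans FK)// /e mulrC divfK.
have M0 : 0 < `|F| + e by rewrite ltr_wpDl.
have mA : measurable (E `&` `]-oo, c]%classic) by exact: measurableI.
apply: (no_gap_not_BSa mk kM M0 mA c0).
- move=> t [/kE ->]; rewrite /= in_itv/= => tc.
  rewrite /rho (max_idPl _) ?mulr0 ?subr0//.
  by rewrite ge_min subr_le0 tc orbT.
- move=> t At; have [Et|Et] := pselect (E t); last first.
    by rewrite (le_lt_trans (kE' _ Et))// ltrBlDr -addrA ltrDl addr_gt0.
  have ct : c < t.
    by rewrite ltNge; apply/negP => tc; apply: At; split=> //=; rewrite in_itv.
  by rewrite kE// ltrBlDr ltrDl mulr_gt0// /rho lt_max lt_min ltr01 subr_gt0 ct orbT.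
(* Within [s] of [c] the loss [e * rho] is at most [r]. *)
move=> r r0; pose s := Num.min 1 (r / e); have s0 : 0 < s by rewrite lt_min ltr01 divr_gt0.
exists (E `&` `]c, c + s]%classic); split; [exact: measurableI|exact: cE|].
move=> t [Et]; rewrite /= in_itv/= => /andP[ct ts]; split.
  by move=> [_]; rewrite /= in_itv/= leNgt ct.
rewrite kE// lerD2l lerN2 mulrC -ler_pdivlMr//.
have rs : s <= r / e by rewrite ge_min lexx orbT.
rewrite /rho ge_max divr_ge0 ?(ltW r0) ?(ltW e0)//= ge_min; apply/orP; right.
by rewrite lerBlDl (le_trans ts)// lerD2l.
Qed.

End L1_01.

Theorem theorem1p5 (R : realType) :
  [/\ dense (BSa (c0 R) R),
      dense (BSa (L1_01 R) R),
      dense (NA (L1_01 R) R `\` BSa (L1_01 R) R),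
      dense (BSa (C01 R) R : set (weak_star_dual (C01 R))) &
      dense (NA (C01 R) R `\` BSa (C01 R) R)].
Proof.
split.
- exact: BSa_c0_dense.
- exact: BSa_L1_dense.
- exact: not_BSa_L1_dense.
- exact: BSa_C01_dense.
- exact: not_BSa_C01_dense.
Qed.
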